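(* Let $k$ be a field and let $\pi:Y\to X$ be a surjective morphism between smooth projective irreducible algebraic curves over $k$ such that the extension of function fields $L/K$, with $K=k(X)$ and $L=k(Y)$, is Galois with cyclic Galois group of order $r$, generated by $\Phi$. Let $x\in K^\times$ and let $E=\sum_{\mathfrak q\in Y^\star}n_{\mathfrak q}\,\mathfrak q\in\mathrm{Div}(Y)\otimes\mathbb{Q}$ be such that $n_{\mathfrak q}\in\frac1{b_{\mathfrak p}}\mathbb{Z}$ for every $\mathfrak q\in Y^\star$, where $\mathfrak p=\pi(\mathfrak q)$. Then the space $\Lambda_{L,x}(E)$ is finite dimensional over $k$ and $$\dim_k\Lambda_{L,x}(E)\ \geq\ r\deg_Y(E)-r(g_Y-1)-\frac{r^2}{2}\sum_{\mathfrak p\in X^\star}\frac{b_{\mathfrak p}-1}{b_{\mathfrak p}e_{\mathfrak p}}\deg_X(\mathfrak p).$$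
   Context: $X^\star$, $Y^\star$ denote the sets of places (closed points) of $X$, $Y$. For a place $\mathfrak p$ of $X$ (resp. $\mathfrak q$ of $Y$), $v_{\mathfrak p}$ (resp. $v_{\mathfrak q}$) is the normalized valuation; $\deg_X(\mathfrak p)$ (resp. $\deg_Y(\mathfrak q)$) is the degree over $k$ of the residue field, and degrees are extended linearly to ($\mathbb{Q}$-)divisors. The ramification index $e_{\mathfrak q}$ of $\mathfrak q$ over $\mathfrak p=\pi(\mathfrak q)$ depends only on $\mathfrak p$ and is also denoted $e_{\mathfrak p}$. $g_Y$ is the genus of $Y$, normalized over $k$, i.e. $1-g_Y=\dim_kH^0(Y,\mathcal{O}_Y)-\dim_kH^1(Y,\mathcal{O}_Y)$ (so that the Riemann–Roch theorem $\dim_kL_Y(D)=\deg_Y(D)+1-g_Y+\dim_kL_Y(K_Y-D)$ holds, with $K_Y$ a canonical divisor). For $\mathfrak p\in X^\star$ write $\frac{e_{\mathfrak p}v_{\mathfrak p}(x)}{r}=\frac{a_{\mathfrak p}}{b_{\mathfrak p}}$ as an irreducible fraction with $b_{\mathfrak p}>0$. $L[T;\Phi]$ is the ring of polynomials in $T$ over $L$ with usual addition and multiplication determined by $T\cdot a=\Phi(a)T$ for $a\in L$; $D_{L,x}=L[T;\Phi]/(T^r-x)$, with left $L$-basis $1,T,\dots,T^{r-1}$. For $f=f_0+f_1T+\dots+f_{r-1}T^{r-1}\in D_{L,x}$ and $\mathfrak q$ above $\mathfrak p$, put $w_{\mathfrak q,x}(f)=\min_{0\le i<r}\big(\frac{v_{\mathfrak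 q}(f_i)}{e_{\mathfrak q}}+i\cdot\frac{v_{\mathfrak p}(x)}{r}\big)$. The Riemann–Roch space is $\Lambda_{L,x}(E)=\{f\in D_{L,x}\mid e_{\mathfrak q}w_{\mathfrak q,x}(f)+n_{\mathfrak q}\ge0\text{ for all }\mathfrak q\in Y^\star\}$. *)

(* Defs.v *)
(* Curves are encoded by their function fields.  A smooth projective
   irreducible curve X over a field k is given by a ring morphism
   j : k -> F = k(X) making F a function field of one variable over k; the
   closed points of X correspond to the normalized discrete valuations of F
   that are trivial on k, the local ring of X at a closed point being the
   valuation ring.  A surjective (hence finite) morphism Y -> X is an
   extension of function fields over k. *)
From HB Require Import structures.
From mathcomp Require Import all_boot all_order all_algebra all_fingroup.
From mathcomp Require Import all_field finmap.
From mathcomp Require Import mathcomp_extra boolp classical_sets functions.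
From mathcomp Require Import cardinality fsbigop constructive_ereal.

Set Implicit Arguments.
Unset Strict Implicit.
Unset Printing Implicit Defensive.

Import Order.TTheory GRing.Theory Num.Theory.

Local Open Scope classical_set_scope.
Local Open Scope ring_scope.

Section Dimension.
Variables (k F : fieldType) (j : {rmorphism k -> F}) (V : lmodType F).

(* For k-subspaces B `<=` A of V: the k-vector space A / B has a basis with n
   elements. *)
Definition has_kdim (A B : set V) (n : nat) : Prop :=
  exists b : 'I_n -> V, (forall i, A (b i)) /\
    forall a, A a -> exists! c : 'rV[k]_n, B (a - \sum_i j (c 0 i) *: b i).

Definition fin_kdim (A B : set V) : Prop := exists n, has_kdim A B n.

(* The dimension of A / B over k; by convention it is 0 if A / B is not finite
   dimensional. *)
Definition kdim (A B : set V) : nat := xget 0%N [set n | has_kdim A B n].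

End Dimension.

Section Curve.
Variables (k F : fieldType) (j : {rmorphism k -> F}).

(* F is finite over j(k)(t) for some t transcendental over j(k): every y in F
   is a combination of b_0, ..., b_(n-1) with coefficients c_i(t) / d(t). *)
Definition function_field : Prop :=
  exists2 t : F, ~ algebraicOver j t &
    exists n (b : 'I_n -> F), forall y : F,
      exists (d : {poly k}) (c : 'I_n -> {poly k}), d != 0 /\
        (map_poly j d).[t] * y = \sum_i (map_poly j (c i)).[t] * b i.

(* The value v 0 = 0 is a placeholder that makes a valuation determined by its
   restriction to the units; see [vale] for the convention v 0 = +oo. *)
Definition normalized_valuation (v : F -> int) : Prop :=
  [/\ v 0 = 0,
      forall c : k, c != 0 -> v (j c) = 0,
      forall a b, a != 0 -> b != 0 -> v (a * b) = v a + v b,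
      forall a b, a != 0 -> b != 0 -> a + b != 0 ->
        Order.min (v a) (v b) <= v (a + b)
    & exists a, v a = 1].

Record place := Place {
  valuation :> F -> int;
  placeP : normalized_valuation valuation }.

HB.instance Definition _ := gen_eqMixin place.
HB.instance Definition _ := gen_choiceMixin place.

Definition vale (p : place) (a : F) : \bar rat :=
  if a == 0 then +oo%E else ((p a)%:~R)%:E.

Definition local_ring (p : place) : set F^o := [set a | (0 <= vale p a)%E].
Definition max_ideal (p : place) : set F^o := [set a | (0 < vale p a)%E].

Definition degree (p : place) : nat := kdim j (local_ring p) (max_ideal p).

(* D represents a k-derivation from the local ring at p to the residue field:
   D a is a lift to the local ring of the value at a. *)
Definition residual_derivation (p : place) (D : F -> F) : Prop :=
  [/\ forall a, local_ring p a -> local_ring p (D a),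
      forall c : k, max_ideal p (D (j c)),
      forall a b, local_ring p a -> local_ring p b ->
        max_ideal p (D (a + b) - (D a + D b))
    & forall a b, local_ring p a -> local_ring p b ->
        max_ideal p (D (a * b) - (a * D b + b * D a))].

(* Smoothness of a curve at p: the fibre at p of the sheaf of differentials
   over k has dimension at most 1 over the residue field.  Its dual is the
   space of k-derivations from the local ring to the residue field, any two
   elements of which are thus required to be linearly dependent. *)
Definition smooth_at (p : place) : Prop :=
  forall D1 D2, residual_derivation p D1 -> residual_derivation p D2 ->
    exists c1 c2, [/\ local_ring p c1, local_ring p c2,
      ~ (max_ideal p c1 /\ max_ideal p c2)
    & forall a, local_ring p a -> max_ideal p (c1 * D1 a + c2 * D2 a)].

Definition smooth_curve : Prop := function_field /\ forall p, smooth_at p.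

(* H^0(O) is the intersection of all local rings. *)
Definition h0 : nat :=
  kdim j [set a : F^o | forall p, local_ring p a] [set 0].

(* H^1(O) is the cokernel of F -> (+)_p F / O_p, i.e. the quotient of the
   space of adeles by the sum of the integral adeles and of the diagonal F. *)
Definition adele : set (place -> F^o) :=
  [set u | finite_set [set p | ~ local_ring p (u p)]].
Definition integral_plus_principal : set (place -> F^o) :=
  [set u | exists a : F, forall p, local_ring p (u p - a)].
Definition h1 : nat := kdim j adele integral_plus_principal.

Definition genus : int := 1 - (h0%:Z - h1%:Z).

Definition divQ := {fsfun place -> rat with 0}.

Definition divQ_degree (E : divQ) : rat :=
  \sum_(p <- finsupp E) E p * (degree p)%:R.

End Curve.

Section Cover.
Variables (k K : fieldType) (iota : {rmorphism k -> K}) (L : fieldExtType K).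

Definition ext_const : {rmorphism k -> L} := in_alg L \o iota.

Section Ramification.
Variable q : place ext_const.

Lemma valM a b : a != 0 -> b != 0 -> q (a * b) = q a + q b.
Proof. by case: (placeP q) => _ _ + _ _; apply. Qed.

Lemma val1 : q 1 = 0.
Proof.
have := @valM 1 1 (oner_neq0 _) (oner_neq0 _).
by rewrite mulr1 -{1}[q 1]addr0 => /addrI.
Qed.

Lemma valN a : q (- a) = q a.
Proof.
have [->|a0] := eqVneq a 0; first by rewrite oppr0.
have N1 : (-1 : L) != 0 by rewrite oppr_eq0 oner_neq0.
have : q (-1) *+ 2 = 0 by rewrite mulr2n -valM // mulrNN mulr1 val1.
move=> /eqP; rewrite mulrn_eq0 /= => /eqP qN1.
by rewrite -mulN1r valM // qN1 add0r.
Qed.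

Lemma valV a : a != 0 -> q a^-1 = - q a.
Proof.
move=> a0; apply/eqP; rewrite -addr_eq0 -valM ?invr_eq0 //.
by rewrite mulVf // val1.
Qed.

Lemma valX a n : a != 0 -> q (a ^+ n) = q a *+ n.
Proof.
move=> a0; elim: n => [|n IHn]; first by rewrite expr0 val1.
by rewrite exprS valM ?expf_neq0 // IHn mulrS.
Qed.

Lemma ram_ex : exists e : nat,
  `[< (0 < e)%N /\ exists2 a : K, a != 0 & q a%:A = e%:Z >].
Proof.
have [u qu] : exists u, q u = 1 by case: (placeP q).
have u0 : u != 0.
  by apply: contra_eqN qu => /eqP ->; case: (placeP q) => ->.
apply: contrapT => noe.
have q0 a : a != 0 -> q a%:A = 0.
  move=> a0; apply: contrapT => qa; apply: noe.
  have aA0 : a%:A != 0 :> L by rewrite scaler_eq0 oner_eq0 orbF.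
  case E : (q a%:A) qa => [[|n]|n] // _.
    by exists n.+1; apply/asboolP; split=> //; exists a.
  exists n.+1; apply/asboolP; split=> //; exists a^-1; first by rewrite invr_eq0.
  by rewrite -in_algE fmorphV valV // E NegzE opprK.
have main (P : {poly K}) : P != 0 ->
    (map_poly (in_alg L) P).[u] != 0 /\ 0 <= q (map_poly (in_alg L) P).[u].
  elim/poly_ind: P => [|P c IH]; first by rewrite eqxx.
  rewrite rmorphD rmorphM /= map_polyX map_polyC !hornerE /= => PX.
  have [c0|c0] := eqVneq c 0.
    have P0 : P != 0 by apply: contra_neq PX => ->; rewrite c0 mul0r addr0.
    have [nz ge] := IH P0.
    rewrite c0 scale0r addr0 mulf_neq0 // valM // qu; split=> //.
    exact: addr_ge0.
  have cA0 : c%:A != 0 :> L by rewrite scaler_eq0 oner_eq0 orbF.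
  have [->|P0] := eqVneq P 0.
    by rewrite rmorph0 horner0 mul0r add0r cA0 q0.
  have [nz ge] := IH P0; set w := _.[u] in nz ge *.
  have wu0 : w * u != 0 by rewrite mulf_neq0.
  have qwu : 0 < q (w * u) by rewrite valM // qu ltr_wpDl.
  have s0 : w * u + c%:A != 0.
    rewrite addr_eq0; apply: contraTneq qwu => ->.
    by rewrite valN q0 // ltxx.
  split=> //; have [_ _ _ + _] := placeP q => /(_ _ _ wu0 cA0 s0).
  by apply: le_trans; rewrite q0 // le_min lexx ltW.
have /polyOver1P[P Dp] := minPolyOver 1 u.
have P0 : P != 0.
  apply: contra_eq_neq Dp => ->; rewrite rmorph0.
  exact: monic_neq0 (monic_minPoly 1 u).
have [+ _] := main _ P0; rewrite -Dp.
by rewrite (eqP (root_minPoly 1 u)) eqxx.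
Qed.

(* The ramification index e_q of q over K: the index of the value group of K,
   i.e. the least positive value of q on K. *)
Definition ram : nat := ex_minn ram_ex.

Lemma ram_gt0 : (0 < ram)%N.
Proof. by rewrite /ram; case: ex_minnP => m /asboolP[]. Qed.

Lemma ram_dvd (a : K) : (ram%:Z %| q a%:A)%Z.
Proof.
rewrite /ram; case: ex_minnP => m /asboolP[m0 [t t0 qt]] mmin.
have [->|a0] := eqVneq a 0; first by rewrite scale0r; case: (placeP q) => ->.
have nzA (c : K) : c != 0 -> c%:A != 0 :> L.
  by move=> c0; rewrite scaler_eq0 oner_eq0 orbF.
have qZ (z : int) : q (t ^ z)%:A = z * m%:Z.
  rewrite -in_algE fmorphXz; case: z => n.
    by rewrite -exprnP valX ?nzA // qt -mulr_natl natz.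
  rewrite NegzE -exprnN valV ?expf_neq0 ?nzA // valX ?nzA // qt -mulr_natl natz.
  by rewrite mulNr.
have m0' : m%:Z != 0 by rewrite eqz_nat -lt0n.
pose z := (q a%:A %/ m%:Z)%Z.
have tz0 : t ^ (- z) != 0 by rewrite expfz_neq0.
have qr : q (a * t ^ (- z))%:A = (q a%:A %% m%:Z)%Z.
  rewrite -in_algE rmorphM /= valM ?nzA // qZ mulNr.
  by rewrite {1}(divz_eq (q a%:A) m%:Z) addrC addKr.
apply/dvdz_mod0P; apply: contrapT => /eqP r0.
have r_ge0 := modz_ge0 (q a%:A) m0'.
have := ltz_pmod (q a%:A) (m0 : 0 < m%:Z).
case: (q a%:A %% m%:Z)%Z qr r0 r_ge0 => [n|//] qr n0 _.
rewrite ltNge lez_nat => /negP; apply; apply: mmin; apply/asboolP; split.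
  by rewrite lt0n -eqz_nat.
by exists (a * t ^ (- z)) => //; rewrite mulf_neq0.
Qed.

Definition under_valuation (a : K) : int := (q a%:A %/ ram%:Z)%Z.

Lemma under_valuationE a : q a%:A = under_valuation a * ram%:Z.
Proof. by rewrite divzK // ram_dvd. Qed.

Lemma under_valuationP : normalized_valuation iota under_valuation.
Proof.
have e0 : 0 < ram%:Z by rewrite ltz_nat ram_gt0.
have eI : injective (fun z => z * ram%:Z) by apply: mulIf; rewrite gt_eqF.
have nzA (c : K) : c != 0 -> c%:A != 0 :> L.
  by move=> c0; rewrite scaler_eq0 oner_eq0 orbF.
have [q0 qk qM qD _] := placeP q.
split.
- by rewrite /under_valuation scale0r q0 div0z.
- by move=> c c0; apply: eI; rewrite -under_valuationE mul0r -(qk c).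
- move=> a b a0 b0; apply: eI; rewrite mulrDl -!under_valuationE.
  by rewrite -in_algE rmorphM /= qM ?nzA.
- move=> a b a0 b0 ab0; rewrite -(ler_pM2r e0) (minr_pMl _ _ (ltW e0)).
  rewrite -!under_valuationE scalerDl; apply: qD; rewrite -?scalerDl; exact: nzA.
- have [a a0 qa] : exists2 a : K, a != 0 & q a%:A = ram%:Z.
    by rewrite /ram; case: ex_minnP => m /asboolP[].
  by exists a; apply: eI; rewrite -under_valuationE mul1r.
Qed.

(* The image of the closed point q under Y -> X. *)
Definition under : place iota := Place under_valuationP.

Lemma underE a : q a%:A = under a * ram%:Z.
Proof. exact: under_valuationE. Qed.

End Ramification.

(* The common value of e_q for q above p; it is meaningful when L is Galois
   over K. *)
Definition ram_at (p : place iota) : nat :=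
  xget 0%N [set ram q | q in [set q | under q = p]].

End Cover.

(* D_{L,x} = L[T; Phi] / (T^r - x) with r = #[Phi]: the element f is the class
   of f_0 + f_1 T + ... + f_(r-1) T^(r-1). *)
Definition cyclic_algebra (K : fieldType) (L : splittingFieldType K)
    (Phi : gal_of {:L}) (x : K) : Type := {ffun 'I_#[Phi]%g -> L^o}.

Section CyclicAlgebra.
Variables (K : fieldType) (L : splittingFieldType K).
Variables (Phi : gal_of {:L}) (x : K).
Local Notation r := #[Phi]%g.
Local Notation D := (cyclic_algebra Phi x).

HB.instance Definition _ := GRing.Lmodule.copy D {ffun 'I_r -> L^o}.

(* The class of a T^n. *)
Definition ca_mono (a : L) (n : nat) : D :=
  [ffun m : 'I_r => if m == (n %% r)%N :> nat then a * (x ^+ (n %/ r)%N)%:A else 0].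

Definition ca_mul (f g : D) : D :=
  \sum_i \sum_j ca_mono (f i * iter i Phi (g j)) (i + j).

Definition ca_one : D := ca_mono 1 0.

Lemma ca_monoD n : {morph ca_mono^~ n : a b / a + b}.
Proof.
move=> a b; apply/ffunP => m; rewrite !ffunE.
by case: eqP => _; rewrite ?mulrDl ?addr0.
Qed.

Lemma ca_mono0 n : ca_mono 0 n = 0.
Proof. by apply/ffunP => m; rewrite !ffunE mul0r if_same. Qed.

Lemma ca_mono_sum I (s : seq I) (F : I -> L) n :
  ca_mono (\sum_(i <- s) F i) n = \sum_(i <- s) ca_mono (F i) n.
Proof. by apply: (big_morph (ca_mono^~ n) (ca_monoD n)); rewrite ca_mono0. Qed.

Lemma ca_sumE (f : D) : f = \sum_i ca_mono (f i) i.
Proof.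
apply/ffunP => m; rewrite sum_ffunE (bigD1 m) //= big1 ?addr0 => [|i im].
  by rewrite ffunE modn_small // eqxx divn_small // expr0 scale1r mulr1.
by rewrite ffunE modn_small // ifN // eq_sym.
Qed.

Lemma iterPhiD n : {morph iter n Phi : a b / a + b}.
Proof. by elim: n => // n IHn a b /=; rewrite IHn rmorphD. Qed.

Lemma iterPhiM n : {morph iter n Phi : a b / a * b}.
Proof. by elim: n => // n IHn a b /=; rewrite IHn rmorphM. Qed.

Lemma iterPhiA n (c : K) : iter n Phi c%:A = c%:A.
Proof. by elim: n => // n IHn /=; rewrite IHn linearZ /= rmorph1. Qed.

Lemma iterPhi0 n : iter n Phi 0 = 0.
Proof. by rewrite -(scale0r (1 : L)) iterPhiA. Qed.

Lemma iterPhi1 n : iter n Phi 1 = 1.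
Proof. by rewrite -(scale1r (1 : L)) iterPhiA. Qed.

Lemma iterPhiX n a : iter n Phi a = (Phi ^+ n)%g a.
Proof.
elim: n => [|n IHn]; first by rewrite expg0 gal_id.
by rewrite expgSr galM ?memvf //= IHn.
Qed.

Lemma iterPhi_order n a : iter (n + r) Phi a = iter n Phi a.
Proof. by rewrite !iterPhiX expgD expg_order mulg1. Qed.

Lemma iterPhi_mod n a : iter (n %% r)%N Phi a = iter n Phi a.
Proof.
rewrite {2}(divn_eq n r) addnC; elim: (n %/ r)%N => [|t IHt].
  by rewrite mul0n addn0.
by rewrite mulSn (addnC r) addnA iterPhi_order IHt.
Qed.

Lemma ca_mono_mod a n : ca_mono a n = ca_mono (a * (x ^+ (n %/ r)%N)%:A) (n %% r)%N.
Proof.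
apply/ffunP => m; rewrite !ffunE modn_mod (divn_small (ltn_pmod _ _)) ?order_gt0 //.
by rewrite expr0 scale1r mulr1.
Qed.

Lemma ca_mulDl : left_distributive ca_mul +%R.
Proof.
move=> f g h; rewrite /ca_mul -big_split /=; apply: eq_bigr => i _.
rewrite -big_split /=; apply: eq_bigr => l _.
by rewrite ffunE mulrDl ca_monoD.
Qed.

Lemma ca_mulDr : right_distributive ca_mul +%R.
Proof.
move=> f g h; rewrite /ca_mul -big_split /=; apply: eq_bigr => i _.
rewrite -big_split /=; apply: eq_bigr => l _.
by rewrite ffunE iterPhiD mulrDr ca_monoD.
Qed.

Lemma ca_mul0l f : ca_mul 0 f = 0.
Proof.
by rewrite /ca_mul big1 // => i _; rewrite big1 // => l _;
  rewrite ffunE mul0r ca_mono0.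
Qed.

Lemma ca_mul0r f : ca_mul f 0 = 0.
Proof.
by rewrite /ca_mul big1 // => i _; rewrite big1 // => l _;
  rewrite ffunE iterPhi0 mulr0 ca_mono0.
Qed.

Lemma ca_mul_small a b i l : (i < r)%N -> (l < r)%N ->
  ca_mul (ca_mono a i) (ca_mono b l) = ca_mono (a * iter i Phi b) (i + l).
Proof.
move=> ir lr; rewrite /ca_mul (bigD1 (Ordinal ir)) //= [X in _ + X]big1.
  rewrite addr0 (bigD1 (Ordinal lr)) //= [X in _ + X]big1.
    rewrite addr0 !ffunE /= !modn_small // !eqxx !divn_small //.
    by rewrite expr0 scale1r !mulr1.
  move=> m ml; rewrite [X in iter _ _ X]ffunE (modn_small lr) ifN.
    by rewrite iterPhi0 mulr0 ca_mono0.
  by apply: contra_neq ml => ml; apply: val_inj.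
move=> m mi; rewrite big1 // => n _; rewrite ffunE (modn_small ir) ifN.
  by rewrite mul0r ca_mono0.
by apply: contra_neq mi => mi; apply: val_inj.
Qed.

Lemma ca_mul_mono a b i l :
  ca_mul (ca_mono a i) (ca_mono b l) = ca_mono (a * iter i Phi b) (i + l).
Proof.
rewrite (ca_mono_mod a i) (ca_mono_mod b l) ca_mul_small ?ltn_pmod ?order_gt0 //.
rewrite iterPhiM iterPhiA iterPhi_mod.
rewrite ca_mono_mod [RHS]ca_mono_mod modnDm.
congr ca_mono; rewrite !mulrA -!(mulrAC _ (iter i Phi b)) -!mulrA.
congr (_ * (_ * _)); rewrite -!in_algE -!rmorphM -!exprD; congr (in_alg L (x ^+ _)).
rewrite [in RHS](divn_eq i r) [in RHS](divn_eq l r) addnACA -mulnDl.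
by rewrite divnMDl ?order_gt0 // addnA.
Qed.

Lemma ca_mulA : associative ca_mul.
Proof.
have suml I (s : seq I) (F : I -> D) g :
    ca_mul (\sum_(i <- s) F i) g = \sum_(i <- s) ca_mul (F i) g.
  by apply: (big_morph (ca_mul^~ g) (fun _ _ => ca_mulDl _ _ _)); rewrite ca_mul0l.
have sumr I (s : seq I) (F : I -> D) g :
    ca_mul g (\sum_(i <- s) F i) = \sum_(i <- s) ca_mul g (F i).
  by apply: (big_morph (ca_mul g) (fun _ _ => ca_mulDr _ _ _)); rewrite ca_mul0r.
move=> f g h; rewrite (ca_sumE f) (ca_sumE g).
rewrite !suml; apply: eq_bigr => i _; rewrite !sumr suml.
apply: eq_bigr => l _; rewrite (ca_sumE h) !sumr; apply: eq_bigr => m _.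
by rewrite !ca_mul_mono iterPhiM iterD mulrA addnA.
Qed.

Lemma ca_mul1l : left_id ca_one ca_mul.
Proof.
move=> f; rewrite {1}(ca_sumE f).
rewrite (big_morph (ca_mul ca_one) (fun _ _ => ca_mulDr _ _ _) (ca_mul0r _)).
by rewrite [RHS]ca_sumE; apply: eq_bigr => i _; rewrite ca_mul_mono mul1r.
Qed.

Lemma ca_mul1r : right_id ca_one ca_mul.
Proof.
move=> f; rewrite {1}(ca_sumE f).
rewrite (big_morph (ca_mul^~ ca_one) (fun _ _ => ca_mulDl _ _ _) (ca_mul0l _)).
rewrite [RHS]ca_sumE; apply: eq_bigr => i _.
by rewrite ca_mul_mono iterPhi1 mulr1 addn0.
Qed.

Lemma ca_one_neq0 : ca_one != 0.
Proof.
apply/eqP => /ffunP /(_ (Ordinal (order_gt0 Phi))); rewrite !ffunE mod0n eqxx.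
by rewrite div0n expr0 scale1r mulr1 => /eqP; rewrite oner_eq0.
Qed.

HB.instance Definition _ := GRing.Zmodule_isNzRing.Build D
  ca_mulA ca_mul1l ca_mul1r ca_mulDl ca_mulDr ca_one_neq0.

Definition ca_T : D := ca_mono 1 1.
Definition ca_const (a : L) : D := ca_mono a 0.

Lemma ca_T_comm a : ca_T * ca_const a = ca_const (Phi a) * ca_T.
Proof. by rewrite /GRing.mul /= !ca_mul_mono mul1r /= mulr1. Qed.

Lemma ca_T_expE n : ca_T ^+ n = ca_mono 1 n.
Proof.
by elim: n => // n IHn; rewrite exprS IHn {1}/GRing.mul /= ca_mul_mono iterPhi1 mulr1.
Qed.

Lemma ca_T_order : ca_T ^+ r = ca_const x%:A.
Proof.
rewrite ca_T_expE /ca_const ca_mono_mod modnn divnn order_gt0 expr1.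
by rewrite mul1r.
Qed.

Lemma ca_basis (f : D) : f = \sum_i ca_const (f i) * ca_T ^+ i.
Proof.
rewrite {1}(ca_sumE f); apply: eq_bigr => i _.
by rewrite ca_T_expE /GRing.mul /= ca_mul_mono mulr1.
Qed.

Lemma ca_scaleE a (f : D) : a *: f = ca_const a * f.
Proof.
rewrite {2}(ca_sumE f) mulr_sumr [LHS]ca_sumE; apply: eq_bigr => i _.
by rewrite /GRing.mul /= ca_mul_mono ffunE.
Qed.

End CyclicAlgebra.

Section RiemannRochSpace.
Variables (k K : fieldType) (iota : {rmorphism k -> K}).
Variables (L : splittingFieldType K) (Phi : gal_of {:L}) (x : K).
Local Notation j := (ext_const iota L).

(* The denominator b_p of e_p v_p(x) / r in lowest terms. *)
Definition slope_denom (p : place iota) : int :=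
  denq (((ram_at L p)%:Z * p x)%:~R / #[Phi]%g%:R).

Definition ca_valuation (q : place j) (f : cyclic_algebra Phi x) : \bar rat :=
  (\big[Order.min/+oo]_(i < #[Phi]%g)
     (vale q (f i) * ((ram q)%:R^-1)%:E
      + (i%:R * ((under q x)%:~R / #[Phi]%g%:R))%:E))%E.

Definition RRspace (E : divQ j) : set (cyclic_algebra Phi x) :=
  [set f | forall q, (0 <= (ram q)%:R%:E * ca_valuation q f + (E q)%:E)%E].

End RiemannRochSpace.

Arguments RRspace {k K iota L} Phi x E.
Arguments slope_denom {k K iota L} Phi x p.

(* Main.v *)
Require Import Defs.
From mathcomp Require Import all_boot all_order all_algebra all_fingroup.
From mathcomp Require Import all_field finmap.
From mathcomp Require Import mathcomp_extra boolp classical_sets functions.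
From mathcomp Require Import cardinality fsbigop constructive_ereal.
From mathcomp Require Import ring lra zify.

Set Implicit Arguments.
Unset Strict Implicit.
Unset Printing Implicit Defensive.

Import Order.TTheory GRing.Theory Num.Theory.

Local Open Scope classical_set_scope.
Local Open Scope ring_scope.

(** The space [RRspace Phi x E] is the direct sum, over the coefficients
    [f_0, ..., f_(r-1)], of the Riemann-Roch spaces of the divisors
    [D_i = sum_q floor (n_q + i e_q v_p(x) / r) q] on [Y]: see [RRspaceE].  By Riemann's
    inequality each of them has dimension at least [deg D_i + 1 - g_Y], and it remains
    to sum the degrees.  At a place [q] above [p], with [e_p v_p(x) / r = a / b] in
    lowest terms, the numerators of [n_q + i a / b] run through all the residues modulo
    [b] equally often, so that the integral parts lose [(b - 1) / (2 b)] on average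
    ([sum_floor]).  The terms [i e_q v_p(x) / r] cancel globally because a principal
    divisor has degree 0 ([div_degree_principal]).  Finally the places [q] above [p]
    are turned into [p] by the inequality [sum_(q | p) e_q deg q <= r deg p]
    ([sum_ram_degree_le]), where the [e_q] for a given [p] are equal because the places
    above [p] are conjugate ([ram_under]).

    Riemann's inequality for the genus defined by adeles rests on one counting argument
    ([kfree_mul_bound]).  Let [b_1, ..., b_n] be a basis of the function field over
    [k(t)], let [z <> 0], and let [B] be a [k]-space with [z B] contained in [B].
    Elements of [B] which are independent modulo [z B] remain so after multiplication by
    the powers [1, z, ..., z^(M-1)], and these products live, up to a common
    denominator, in a space of polynomial combinations of the [b_i] of dimension
    [O(M)].  This bounds [dim B / z B].  For [B] a local ring it shows that residue
    fields are finite over [k]; with weak approximation, for [B] a semilocal ring, it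
    bounds the degree of the divisor of zeros of [z] ([zeros_degree_le]).  Conversely the
    [t^s b_i] provide many functions with poles only at those of [t] ([ell_poles]).
    Together these facts show that [deg D - dim L(D)] is bounded ([riemann_bound]).  If
    [D0] realizes the maximum, then every adele is the sum of one bounded by [D0] and of
    a function, which computes [h1] and identifies the maximum with [g - 1]
    ([genus_extremal]).

    The spaces [L(D)] are finite dimensional because a function without poles is
    algebraic over [k]: a transcendental [a] has a pole ([pole_ex]).  That place comes
    from a subring which is maximal among those containing [k[1/a]] but not [a].  It is
    a valuation ring, and the counting argument makes its ideals of finite codimension,
    so that the valuation is discrete. *)

(** * Dimension of quotients of subspaces *)

Section Dimension.
Variables (k F : fieldType) (j : {rmorphism k -> F}).

Section OneSpace.
Variable V : lmodType F.
Implicit Types (A B C : set V) (I J : finType).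

Definition ksubspace A : Prop :=
  [/\ A 0, forall u v, A u -> A v -> A (u + v)
    & forall (c : k) u, A u -> A (j c *: u)].

Definition kcomb I (c : I -> k) (b : I -> V) : V := \sum_i j (c i) *: b i.

Definition kfree B I (b : I -> V) : Prop :=
  forall c, B (kcomb c b) -> forall i, c i = 0.

Definition kspan B I (b : I -> V) (a : V) : Prop :=
  exists c, B (a - kcomb c b).

Definition kbasis A B I (b : I -> V) : Prop :=
  [/\ forall i, A (b i), kfree B b & forall a, A a -> kspan B b a].

Lemma ksubN A u : ksubspace A -> A u -> A (- u).
Proof. by case=> _ _ AZ Au; rewrite -scaleN1r -(rmorphN1 j); apply: AZ. Qed.

Lemma ksubB A u v : ksubspace A -> A u -> A v -> A (u - v).
Proof. by move=> sA Au Av; have [_ AD _] := sA; apply: AD => //; apply: ksubN. Qed.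

Lemma ksub_sum A I (b : I -> V) (P : pred I) : ksubspace A ->
  (forall i, P i -> A (b i)) -> A (\sum_(i | P i) b i).
Proof. by move=> [A0 AD _] Ab; apply: big_ind. Qed.

Lemma ksub_comb A I (c : I -> k) (b : I -> V) : ksubspace A ->
  (forall i, A (b i)) -> A (kcomb c b).
Proof.
by move=> sA Ab; apply: ksub_sum => // i _; have [_ _ AZ] := sA; apply: AZ.
Qed.

Lemma kcombD I (c d : I -> k) (b : I -> V) :
  kcomb (fun i => c i + d i) b = kcomb c b + kcomb d b.
Proof.
by rewrite /kcomb -big_split; apply: eq_bigr => i _; rewrite rmorphD scalerDl.
Qed.

Lemma kcombZ I (a : k) (c : I -> k) (b : I -> V) :
  kcomb (fun i => a * c i) b = j a *: kcomb c b.
Proof.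
by rewrite /kcomb scaler_sumr; apply: eq_bigr => i _; rewrite rmorphM scalerA.
Qed.

Lemma kcombN I (c : I -> k) (b : I -> V) :
  kcomb (fun i => - c i) b = - kcomb c b.
Proof.
by rewrite /kcomb -sumrN; apply: eq_bigr => i _; rewrite rmorphN scaleNr.
Qed.

Lemma kcomb0 I (b : I -> V) : kcomb (fun=> 0) b = 0.
Proof. by rewrite /kcomb big1 // => i _; rewrite rmorph0 scale0r. Qed.

Lemma kspan_sub B I (b : I -> V) u : ksubspace B -> B u -> kspan B b u.
Proof. by move=> sB Bu; exists (fun=> 0); rewrite kcomb0 subr0. Qed.

(** The exchange lemma: the coordinates of the [b i] on the [e l] form a matrix
    which has a nonzero row kernel as soon as it has more rows than columns. *)
Lemma kfree_leq_kspan B I J (b : I -> V) (e : J -> V) : ksubspace B ->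
  kfree B b -> (forall i, kspan B e (b i)) -> (#|I| <= #|J|)%N.
Proof.
move=> sB bfree bspan.
have [c cP] := choice bspan.
pose M : 'M[k]_(#|I|, #|J|) := \matrix_(i, l) c (enum_val i) (enum_val l).
rewrite leqNgt; apply/negP => lt.
have kerM : kermx M != 0.
  rewrite -mxrank_eq0 mxrank_ker -lt0n subn_gt0.
  exact: leq_ltn_trans (rank_leq_col M) lt.
have [i0 w0] : exists i, row i (kermx M) != 0.
  apply: contrapT => /forallNP noi; move/eqP: kerM; apply.
  by apply/row_matrixP => i; rewrite row0; apply/eqP/negbNE/negP/noi.
set w := row i0 _ in w0.
have wM : w *m M = 0 by rewrite -row_mul mulmx_ker row0.
have [_ _ BZ] := sB.
move/negP: w0; apply; apply/eqP/rowP => a; rewrite [RHS]mxE.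
rewrite -[a]enum_valK; move: (enum_val a).
apply: (bfree (fun i => w 0 (enum_rank i))).
suff -> : kcomb (fun i => w 0 (enum_rank i)) b =
    \sum_i j (w 0 (enum_rank i)) *: (b i - kcomb (c i) e).
  by apply: ksub_sum => // i _; apply/BZ/cP.
apply/eqP; rewrite -subr_eq0 /kcomb -sumrB; apply/eqP.
under eq_bigr => i _ do rewrite -scalerBr opprB addrC subrK scaler_sumr.
rewrite exchange_big /= big1 // => l _.
under eq_bigr => i _ do rewrite scalerA -rmorphM.
rewrite -scaler_suml -rmorph_sum /=.
rewrite (_ : \sum_i _ = 0) ?rmorph0 ?scale0r //.
have /rowP/(_ (enum_rank l)) := wM; rewrite !mxE => wMl; rewrite -[RHS]wMl.
rewrite (reindex (@enum_rank I)) /=; last exact: onW_bij (enum_rank_bij I).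
by apply: eq_bigr => i _; rewrite !mxE !enum_rankK.
Qed.

Lemma kbasis_kdim A B I (b : I -> V) : ksubspace B ->
  kbasis A B b -> has_kdim j A B #|I|.
Proof.
move=> sB [Ab bfree bspan].
have [_ BD _] := sB.
have combE (c : 'rV[k]_#|I|) :
    \sum_i j (c 0 i) *: b (enum_val i) = kcomb (fun i => c 0 (enum_rank i)) b.
  rewrite /kcomb [LHS](reindex (@enum_rank I)) /=.
    by apply: eq_bigr => i _; rewrite enum_rankK.
  exact: onW_bij (enum_rank_bij I).
exists (b \o enum_val); split=> [i|a Aa]; first exact: Ab.
have [c Bc] := bspan a Aa.
exists (\row_i c (enum_val i)); split=> [|d /=].
  rewrite combE; congr (B (a - kcomb _ b)): Bc.
  by apply/funext => i; rewrite mxE enum_rankK.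
rewrite combE => Bd; apply/rowP => i; rewrite mxE.
apply/eqP; rewrite -subr_eq0; apply/eqP; rewrite -[i]enum_valK.
move: (enum_val i) => {}i; rewrite enum_rankK.
apply: (bfree (fun i => c i - d 0 (enum_rank i))).
rewrite kcombD kcombN; have := ksubB sB Bd Bc.
by rewrite opprB addrC addrA subrK addrC.
Qed.

Lemma has_kdim_basis A B n : ksubspace B ->
  has_kdim j A B n -> exists b : 'I_n -> V, kbasis A B b.
Proof.
move=> sB [b [Ab bu]]; exists b; split=> // [c Bc|a Aa]; last first.
  by have [c [Bc _]] := bu a Aa; exists (c 0).
have [B0 BD BZ] := sB.
move=> i; have [d [Bd du]] := bu _ (Ab i).
suff /rowP/(_ i) : d = \row_l (d 0 l - c l).
  by rewrite !mxE => /eqP; rewrite -subr_eq0 opprB addrC subrK => /eqP.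
apply: du; rewrite (_ : \sum_i _ = kcomb (fun l => d 0 l - c l) b).
  by rewrite kcombD kcombN opprD opprK addrA; apply: BD.
by apply: eq_bigr => l _; rewrite mxE.
Qed.

Lemma kfree_leq_kdim A B n I (b : I -> V) : ksubspace B ->
  has_kdim j A B n -> kfree B b -> (forall i, A (b i)) -> (#|I| <= n)%N.
Proof.
move=> sB /(has_kdim_basis sB)[e [_ _ espan]] bfree Ab.
by rewrite -[n]card_ord; apply: kfree_leq_kspan sB bfree _ => i; apply: espan.
Qed.

Lemma kspan_geq_kdim A B n J (e : J -> V) : ksubspace B ->
  has_kdim j A B n -> (forall a, A a -> kspan B e a) -> (n <= #|J|)%N.
Proof.
move=> sB /(has_kdim_basis sB)[b [Ab bfree _]] espan.
by rewrite -[n]card_ord; apply: kfree_leq_kspan sB bfree _ => i; apply: espan.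
Qed.

Lemma has_kdim_uniq A B m n : ksubspace B ->
  has_kdim j A B m -> has_kdim j A B n -> m = n.
Proof.
move=> sB dm dn; apply/eqP; rewrite eqn_leq.
have [b [Ab bfree _]] := has_kdim_basis sB dm.
have [e [Ae efree _]] := has_kdim_basis sB dn.
have := kfree_leq_kdim sB dn bfree Ab; have := kfree_leq_kdim sB dm efree Ae.
by rewrite !card_ord => -> ->.
Qed.

Lemma kdimE A B n : ksubspace B -> has_kdim j A B n -> kdim j A B = n.
Proof.
move=> sB dn; rewrite /kdim; case: xgetP => [m _ dm|no].
  exact: has_kdim_uniq sB dm dn.
by have := no n dn.
Qed.

(** A free family of maximal size is a basis, so that a bound for the free families
    is all it takes to prove that a dimension is finite. *)
Lemma has_kdim_bounded A B N : ksubspace A -> ksubspace B ->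
  (forall n (b : 'I_n -> V), (forall i, A (b i)) -> kfree B b -> (n <= N)%N) ->
  exists2 n, (n <= N)%N & has_kdim j A B n.
Proof.
move=> sA sB bound.
pose P n := `[< exists b : 'I_n -> V, (forall i, A (b i)) /\ kfree B b >].
have P0 : exists n, P n.
  exists 0%N; apply/asboolP; exists (fun=> 0); split; first by case.
  by move=> c _ [].
have PN n : P n -> (n <= N)%N by move=> /asboolP[b [Ab bf]]; exact: bound bf.
have [n /asboolP[b [Ab bfree]] nmax] := ex_maxnP P0 PN.
exists n; first by apply: bound bfree.
rewrite -[n]card_ord; apply: (kbasis_kdim (b := b)) => //; split=> // a Aa.
apply: contrapT => nspan.
suff /nmax : P n.+1 by rewrite ltnn.
apply/asboolP; pose b' (i : 'I_n.+1) := if unlift ord0 i is Some l then b l else a.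
exists b'; split=> [i|c Bc]; first by rewrite /b'; case: unlift.
have cE : kcomb c b' = j (c ord0) *: a + kcomb (fun l => c (lift ord0 l)) b.
  rewrite /kcomb big_ord_recl /b' unlift_none; congr (_ + _).
  by apply: eq_bigr => l _; rewrite liftK.
have c0 : c ord0 = 0.
  apply: contrapT => /eqP c0; apply: nspan.
  exists (fun l => - (c ord0)^-1 * c (lift ord0 l)); rewrite kcombZ.
  have [_ _ BZ] := sB.
  have := BZ (c ord0)^-1 _ Bc.
  rewrite cE scalerDr scalerA -rmorphM mulVf // rmorph1 scale1r.
  by rewrite rmorphN scaleNr opprK.
move: Bc; rewrite cE c0 rmorph0 scale0r add0r => /bfree cl i.
by case: (unliftP ord0 i) => [l|] ->.
Qed.

Lemma has_kdim_trans A C B m n : ksubspace C -> ksubspace B ->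
  B `<=` C -> C `<=` A ->
  has_kdim j A C m -> has_kdim j C B n -> has_kdim j A B (m + n)%N.
Proof.
move=> sC sB BC CA /(has_kdim_basis sC)[b [Ab bfree bspan]].
move=> /(has_kdim_basis sB)[e [Ce efree espan]].
have -> : (m + n)%N = #|{: 'I_m + 'I_n}| by rewrite card_sum !card_ord.
pose f (s : 'I_m + 'I_n) := match s with inl i => b i | inr i => e i end.
have fE (c : 'I_m + 'I_n -> k) :
    kcomb c f = kcomb (c \o inl) b + kcomb (c \o inr) e.
  by rewrite /kcomb big_sumType.
apply: (kbasis_kdim (b := f)) => //; split=> [[i|i]|c|a Aa] /=; first exact: Ab.
- exact/CA/Ce.
- rewrite fE => Bc.
  have c1 : forall i, c (inl i) = 0.
    apply: (bfree (c \o inl)).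
    have := ksubB sC (BC _ Bc) (ksub_comb (c \o inr) sC Ce).
    by rewrite addrK.
  have c2 : forall i, c (inr i) = 0.
    apply: (efree (c \o inr)).
    rewrite (_ : kcomb (c \o inl) b = 0) ?add0r // in Bc.
    by rewrite /kcomb big1 // => i _; rewrite /= c1 rmorph0 scale0r.
  by case.
- have [c Cc] := bspan a Aa; have [d Bd] := espan _ Cc.
  exists (fun s => match s with inl i => c i | inr i => d i end).
  by rewrite fE /= opprD addrA.
Qed.

Lemma has_kdim_split A C B n : ksubspace A -> ksubspace C -> ksubspace B ->
  B `<=` C -> C `<=` A -> has_kdim j A B n ->
  exists m1 m2, [/\ has_kdim j A C m1, has_kdim j C B m2 & n = (m1 + m2)%N].
Proof.
move=> sA sC sB BC CA dn.
have [|m1 _ d1] := @has_kdim_bounded A C n sA sC.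
  move=> s b Ab bfree; rewrite -[s]card_ord; apply: kfree_leq_kdim sB dn _ Ab.
  by move=> c /BC; apply: bfree.
have [|m2 _ d2] := @has_kdim_bounded C B n sC sB.
  move=> s b Cb bfree; rewrite -[s]card_ord; apply: kfree_leq_kdim sB dn bfree _.
  by move=> i; apply/CA.
exists m1, m2; split=> //.
exact: (has_kdim_uniq sB dn (has_kdim_trans sC sB BC CA d1 d2)).
Qed.

Lemma has_kdim0P A B : ksubspace B -> has_kdim j A B 0 -> A `<=` B.
Proof.
move=> sB /(has_kdim_basis sB)[b [_ _ bspan]] a /bspan[c].
by rewrite /kcomb big_ord0 subr0.
Qed.

Lemma has_kdim_refl A : ksubspace A -> has_kdim j A A 0.
Proof.
move=> sA; rewrite -[0%N]card_ord; apply: (kbasis_kdim (b := fun=> 0)) => //.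
split; [by case | by move=> c _ [] | by move=> a Aa; apply: kspan_sub].
Qed.

End OneSpace.

Lemma kcomb_linear (V V' : lmodType F) (phi : V -> V') (I : finType)
    (c : I -> k) (b : I -> V) : linear phi ->
  phi (kcomb c b) = kcomb c (phi \o b).
Proof.
move=> lphi; have phi0 : phi 0 = 0.
  by have := lphi (-1) 0 0; rewrite scaler0 addr0 scaleN1r addNr.
rewrite /kcomb; elim: (index_enum I) => [|i s IHs]; first by rewrite !big_nil.
by rewrite !big_cons lphi IHs.
Qed.

(** The hypotheses say that [phi] induces an isomorphism of [A / B] onto [A' / B']. *)
Lemma has_kdim_iso (V V' : lmodType F) (phi : V -> V')
    (A B : set V) (A' B' : set V') n :
  linear phi -> ksubspace B -> ksubspace B' ->
  (forall a, A a -> A' (phi a)) -> (forall a, B a -> B' (phi a)) ->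
  (forall a, B' (phi a) -> A a -> B a) -> ksubspace A ->
  (forall a', A' a' -> exists2 a, A a & B' (a' - phi a)) ->
  has_kdim j A B n <-> has_kdim j A' B' n.
Proof.
move=> lphi sB sB' AA' BB' inj sA surj.
have phiB u v : phi (u - v) = phi u - phi v.
  have := lphi (-1) v u; rewrite !scaleN1r [- v + u]addrC => ->.
  by rewrite addrC.
split=> [/(has_kdim_basis sB)|/(has_kdim_basis sB')] [b [Ab bfree bspan]].
  rewrite -[n]card_ord; apply: (kbasis_kdim (b := phi \o b)) => //; split.
  - by move=> i; apply/AA'.
  - move=> c; rewrite -kcomb_linear // => /inj Bc; apply/bfree/Bc.
    exact: ksub_comb.
  - move=> a' /surj[a Aa B'a]; have [c Bc] := bspan a Aa; exists c.
    have [_ B'D _] := sB'; have := B'D _ _ B'a (BB' _ Bc).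
    by rewrite phiB kcomb_linear // addrA subrK.
have ex_e i : exists e, A e /\ B' (b i - phi e).
  by have [e] := surj _ (Ab i); exists e.
have [e eP] := choice ex_e.
have combB c : B' (kcomb c b - phi (kcomb c e)).
  rewrite (kcomb_linear c e lphi) /kcomb -sumrB; apply: ksub_sum => // i _.
  by rewrite -scalerBr; have [_ _] := sB'; apply; case: (eP i).
have Ae i : A (e i) by case: (eP i).
have [_ B'D _] := sB'.
rewrite -[n]card_ord; apply: (kbasis_kdim (b := e)) => //; split=> //.
  move=> c /BB' B'c; apply: bfree; have := B'D _ _ (combB c) B'c.
  by rewrite subrK.
move=> a Aa; have [c B'c] := bspan _ (AA' _ Aa); exists c; apply: inj.
  rewrite phiB; have := B'D _ _ B'c (combB c).
  by rewrite addrA subrK.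
by apply: ksubB => //; apply: ksub_comb.
Qed.

End Dimension.

(** * Places and weak approximation *)

Section Places.
Variables (k F : fieldType) (j : {rmorphism k -> F}).
Implicit Types (p q : place j) (S : seq (place j)) (a b : F).

Lemma placev0 p : p 0 = 0.
Proof. by case: (placeP p). Qed.

Lemma placevM p a b : a != 0 -> b != 0 -> p (a * b) = p a + p b.
Proof. by case: (placeP p) => _ _ + _ _; apply. Qed.

Lemma placev_const p (c : k) : p (j c) = 0.
Proof.
have [->|c0] := eqVneq c 0; first by rewrite rmorph0 placev0.
by case: (placeP p) => _ + _ _ _; apply.
Qed.

Lemma placev1 p : p 1 = 0.
Proof. by rewrite -(rmorph1 j) placev_const. Qed.

Lemma placevN p a : p (- a) = p a.
Proof.
have [->|a0] := eqVneq a 0; first by rewrite oppr0.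
rewrite -mulN1r placevM ?oppr_eq0 ?oner_eq0 //.
by rewrite -(rmorphN1 j) placev_const add0r.
Qed.

Lemma placevV p a : p a^-1 = - p a.
Proof.
have [->|a0] := eqVneq a 0; first by rewrite invr0 placev0 oppr0.
by apply/eqP; rewrite -addr_eq0 -placevM ?invr_eq0 // mulVf // placev1.
Qed.

Lemma placevX p a n : p (a ^+ n) = p a *+ n.
Proof.
have [->|a0] := eqVneq a 0.
  by rewrite expr0n placev0 mul0rn; case: n => [|n]; rewrite ?placev1 ?placev0.
elim: n => [|n IHn]; first by rewrite expr0 placev1.
by rewrite exprS placevM ?expf_neq0 // IHn mulrS.
Qed.

Lemma placevXz p a (n : int) : p (a ^ n) = p a * n.
Proof.
case: n => n; first by rewrite -exprnP placevX -mulr_natr natz.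
by rewrite NegzE -exprnN placevV placevX -mulr_natr natz mulrN.
Qed.

Lemma uniformizer p : exists2 u, u != 0 & p u = 1.
Proof.
have [u pu] : exists u, p u = 1 by case: (placeP p).
by exists u => //; apply: contra_eq_neq pu => ->; rewrite placev0.
Qed.

Lemma placev_onto p (n : int) : exists2 u, u != 0 & p u = n.
Proof.
have [u u0 pu] := uniformizer p.
by exists (u ^ n); rewrite ?expfz_neq0 // placevXz pu mul1r.
Qed.

Lemma placevD p a b : a != 0 -> b != 0 -> a + b != 0 ->
  Order.min (p a) (p b) <= p (a + b).
Proof. by case: (placeP p) => _ _ _ + _; apply. Qed.

(** The [n]-th power of the maximal ideal at [p], as a fractional ideal.  Membership
    in these sets absorbs the convention on the valuation of zero. *)
Definition vge p (n : int) : set F^o := [set a | (a == 0) || (n <= p a)].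

Lemma vgeE p n a : a != 0 -> vge p n a = (n <= p a) :> Prop.
Proof. by rewrite /vge /= => /negbTE->. Qed.

Lemma vge0 p n : vge p n 0.
Proof. by rewrite /vge /= eqxx. Qed.

Lemma vgeD p n a b : vge p n a -> vge p n b -> vge p n (a + b).
Proof.
have [->|a0] := eqVneq a 0; first by rewrite add0r.
have [->|b0] := eqVneq b 0; first by rewrite addr0.
have [->|ab0] := eqVneq (a + b) 0; first by move=> _ _; exact: vge0.
rewrite !vgeE // => na nb; apply: le_trans (placevD p a0 b0 ab0).
by rewrite le_min na.
Qed.

Lemma vgeM p m n a b : vge p m a -> vge p n b -> vge p (m + n) (a * b).
Proof.
have [->|a0] := eqVneq a 0; first by rewrite mul0r => _ _; exact: vge0.
have [->|b0] := eqVneq b 0; first by rewrite mulr0 => _ _; exact: vge0.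
by rewrite !vgeE ?mulf_neq0 // placevM // => ? ?; apply: lerD.
Qed.

Lemma vge_le p m n a : (m <= n)%R -> vge p n a -> vge p m a.
Proof. by move=> mn; rewrite /vge /= => /orP[->//|/(le_trans mn)->]; rewrite orbT. Qed.

Lemma vgeN p n a : vge p n a -> vge p n (- a).
Proof. by rewrite /vge /= oppr_eq0 placevN. Qed.

Lemma vgeB p n a b : vge p n a -> vge p n b -> vge p n (a - b).
Proof. by move=> na nb; apply/vgeD/vgeN. Qed.

Lemma vge_const p (c : k) : vge p 0 (j c).
Proof. by rewrite /vge /= placev_const lexx orbT. Qed.

Lemma vge_subspace p n : ksubspace j (vge p n).
Proof.
split; [exact: vge0 | exact: vgeD |] => c u nu.
by rewrite -[n]add0r; apply: vgeM => //; exact: vge_const.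
Qed.

Lemma vge_self p a : vge p (p a) a.
Proof. by rewrite /vge /= lexx orbT. Qed.

Lemma vge_mulE p n z a : z != 0 -> vge p n (z * a) <-> vge p (n - p z) a.
Proof.
move=> z0; split=> na.
  have := vgeM (vge_self p z^-1) na.
  by rewrite mulKf // placevV addrC.
by have := vgeM (vge_self p z) na; rewrite addrC subrK.
Qed.

Lemma local_ringE p : local_ring p = vge p 0.
Proof.
apply/seteqP; split=> a; rewrite /local_ring /vge /= /vale.
  by case: eqP => // _; rewrite lee_fin ler0z.
by case: eqP => //= _; rewrite lee_fin ler0z.
Qed.

Lemma max_idealE p : max_ideal p = vge p 1.
Proof.
apply/seteqP; split=> a; rewrite /max_ideal /vge /= /vale.
  by case: eqP => // _; rewrite lte_fin ltr0z -gtz0_ge1.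
by case: eqP => //= _; rewrite lte_fin ltr0z -gtz0_ge1.
Qed.

Lemma placevD_lt p a b : a != 0 -> (b == 0) || (p a < p b) ->
  a + b != 0 /\ p (a + b) = p a.
Proof.
move=> a0; have [->|b0 /= ab] := eqVneq b 0; first by rewrite addr0.
have s0 : a + b != 0.
  by apply: contraTneq ab => /eqP; rewrite addr_eq0 => /eqP->; rewrite placevN ltxx.
split=> //; apply/eqP; rewrite eq_le; apply/andP; split; last first.
  by apply: le_trans (placevD p a0 b0 s0); rewrite le_min lexx ltW.
have := placevD p s0 (_ : - b != 0); rewrite oppr_eq0 addrK => /(_ b0 a0).
by rewrite placevN ge_min => /orP[//|]; rewrite leNgt ab.
Qed.

Lemma place_inj p q : (forall a, p a = q a) -> p = q.
Proof.
case: p q => v vP [w wP] /= /funext vw; subst w.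
by congr Place; apply: Prop_irrelevance.
Qed.

(** If the positivity of [p] implied that of [q] then the units of [p] would be
    units of [q], so [q] would be a multiple of [p], hence equal to it because
    both are normalized. *)
Lemma place_separate_weak p q : p != q -> exists2 a, a != 0 & 0 < p a /\ q a <= 0.
Proof.
move=> pq; apply: contrapT => no.
have pos a : 0 < p a -> 0 < q a.
  move=> pa; rewrite ltNge; apply/negP => qa; apply: no.
  by exists a => //; apply: contraTneq pa => ->; rewrite placev0 ltxx.
have [u u0 pu] := uniformizer p.
have qu : 0 < q u by apply: pos; rewrite pu.
have unit a : a != 0 -> p a = 0 -> q a = 0.
  move=> a0 pa; have lin (n : int) : 0 < q a * n + q u.
    have : 0 < q (a ^ n * u).
      by apply: pos; rewrite placevM ?expfz_neq0 // placevXz pa mul0r pu.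
    by rewrite placevM ?expfz_neq0 // placevXz.
  have := lin (q u); have := lin (- q u); nia.
have qE a : q a = p a * q u.
  have [->|a0] := eqVneq a 0; first by rewrite !placev0 mul0r.
  have : q (a * u ^ (- p a)) = 0.
    apply: unit; first by rewrite mulf_neq0 ?expfz_neq0.
    by rewrite placevM ?expfz_neq0 // placevXz pu mul1r subrr.
  rewrite placevM ?expfz_neq0 // placevXz mulrN => /eqP; rewrite subr_eq0 => /eqP->.
  by rewrite mulrC.
have [w w0 qw] := uniformizer q.
have qu1 : q u = 1.
  have := qE w; rewrite qw; have [pw|pw] := lerP (p w) 0; nia.
by move/eqP: pq; apply; apply: place_inj => a; rewrite qE qu1 mulr1.
Qed.

Lemma place_separate p q : p != q -> exists2 a, a != 0 & 0 < p a /\ q a < 0.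
Proof.
move=> pq; have [a a0 [pa qa]] := place_separate_weak pq.
have [b b0 [qb pb]] : exists2 b, b != 0 & 0 < q b /\ p b <= 0.
  by apply: place_separate_weak; rewrite eq_sym.
by exists (a / b); rewrite ?mulf_neq0 ?invr_eq0 // !placevM ?invr_eq0 // !placevV; lia.
Qed.

Lemma ler_bound (T : eqType) (s : seq T) (f : T -> int) :
  exists N : nat, forall t : T, t \in s -> f t <= N.
Proof.
elim: s => [|t s [N NP]]; first by exists 0%N.
exists (maxn N `|f t|) => t'; rewrite inE => /orP[/eqP->|/NP]; lia.
Qed.

(** By induction on [S]: the function [y] obtained for [S] is corrected to
    [z + y ^+ N] with [z] adapted to one more place [q'].  For [N] large the power
    dominates on [S], while [z] dominates at [q'] unless [y] was already good there. *)
Lemma place_separate_seq p S : p \notin S ->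
  exists2 a, a != 0 & 0 < p a /\ forall q, q \in S -> q a < 0.
Proof.
elim: S => [_|q' S IHS].
  by have [u u0 pu] := uniformizer p; exists u => //; rewrite pu.
rewrite inE negb_or => /andP[pq' /IHS[y y0 [py yS]]].
have [z z0 [pz q'z]] := place_separate pq'.
have [q'y|q'y] := ltP (q' y) 0.
  by exists y => //; split=> // q; rewrite inE => /orP[/eqP->|/yS].
have [N NP] := ler_bound S (fun q => - q z).
have q'w : z + y ^+ N.+1 != 0 /\ q' (z + y ^+ N.+1) = q' z.
  apply: placevD_lt => //; apply/orP; right; rewrite placevX.
  by apply: lt_le_trans q'z _; apply: mulrn_wge0.
have [w0 q'wE] := q'w; exists (z + y ^+ N.+1) => //; split.
  rewrite gtz0_ge1 -vgeE //; apply: vgeD; first by rewrite vgeE // -gtz0_ge1.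
  by rewrite vgeE ?expf_neq0 // placevX -gtz0_ge1 pmulrn_rgt0.
move=> q; rewrite inE => /orP[/eqP->|qS]; first by rewrite q'wE.
have qy := yS q qS; have := NP q qS => qN.
have [_] : y ^+ N.+1 + z != 0 /\ q (y ^+ N.+1 + z) = q (y ^+ N.+1).
  apply: placevD_lt; first by rewrite expf_neq0.
  by apply/orP; right; rewrite placevX -mulr_natr; nia.
rewrite [y ^+ _ + z]addrC => ->; rewrite placevX -mulr_natr; nia.
Qed.

(** When [y] is positive at [p] and negative on [S], the functions [1 / (1 + y ^+ m)]
    tend to 1 at [p] and to 0 on [S]. *)
Lemma approx_indicator p S (n : int) : p \notin S ->
  exists e, vge p n (e - 1) /\ forall q, q \in S -> vge q n e.
Proof.
move=> pS; have [y y0 [py yS]] := place_separate_seq pS.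
pose m := `|n|.+1%N; have mE : (m%:Z = `|n| + 1)%R by rewrite /m; lia.
have ym0 : y ^+ m != 0 by rewrite expf_neq0.
have [s0 ps] : 1 + y ^+ m != 0 /\ p (1 + y ^+ m) = p 1.
  apply: placevD_lt; rewrite ?oner_eq0 //; apply/orP; right.
  by rewrite placev1 placevX pmulrn_rgt0.
exists (1 + y ^+ m)^-1; split.
  have -> : (1 + y ^+ m)^-1 - 1 = - (y ^+ m / (1 + y ^+ m)).
    rewrite -mulNr; apply: (mulIf s0); rewrite mulrBl mulVf // mulfVK // mul1r; ring.
  apply: vgeN; rewrite vgeE ?mulf_neq0 ?invr_eq0 // placevM ?invr_eq0 //.
  by rewrite placevV ps placev1 oppr0 addr0 placevX -mulr_natr; nia.
move=> q /yS qy; have [_ qs] : y ^+ m + 1 != 0 /\ q (y ^+ m + 1) = q (y ^+ m).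
  apply: placevD_lt => //; apply/orP; right.
  rewrite placev1 placevX -mulr_natr; nia.
rewrite vgeE ?invr_eq0 // placevV addrC qs placevX -mulr_natr; nia.
Qed.

(** The approximation [y] on [S] is corrected at [p] by a multiple [e * c] of the gap
    [c], where [e] is an approximate indicator of [p]; its precision [N] makes up
    for the poles of [c]. *)
Theorem weak_approximation S (a : place j -> F) (n : place j -> int) : uniq S ->
  exists y, forall p, p \in S -> vge p (n p) (y - a p).
Proof.
elim: S => [_|p S IHS /= /andP[pS /IHS[y yP]]]; first by exists 0.
pose c := a p - y.
have [N NP] := ler_bound (p :: S) (fun q => n q - q c).
have [e [ep eS]] := approx_indicator N pS.
have prec q b : q \in p :: S -> vge q N b -> vge q (n q) (b * c).
  move=> /NP qN qb; apply: vge_le (vgeM qb (vge_self q c)).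
  by rewrite -lerBlDr.
exists (y + e * c) => q; rewrite inE => /orP[/eqP->|qS].
  have -> : y + e * c - a p = (e - 1) * c by rewrite /c; ring.
  by apply: prec => //; rewrite inE eqxx.
rewrite addrAC; apply: vgeD; first exact: yP.
by apply: prec; [rewrite inE qS orbT | exact: eS].
Qed.

End Places.

(** * Polynomial coordinates and the counting argument *)

Section Counting.
Variables (k F : fieldType) (j : {rmorphism k -> F}).

Definition pev (t : F) (f : {poly k}) : F := (map_poly j f).[t].

Lemma pevD t f g : pev t (f + g) = pev t f + pev t g.
Proof. by rewrite /pev rmorphD hornerD. Qed.

Lemma pevM t f g : pev t (f * g) = pev t f * pev t g.
Proof. by rewrite /pev rmorphM hornerM. Qed.

Lemma pev1 t : pev t 1 = 1.
Proof. by rewrite /pev rmorph1 hornerC. Qed.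

Lemma pevXn t n : pev t 'X^n = t ^+ n.
Proof. by rewrite /pev map_polyXn hornerXn. Qed.

Lemma pevC t c : pev t c%:P = j c.
Proof. by rewrite /pev map_polyC hornerC. Qed.

Lemma pevX t f n : pev t (f ^+ n) = pev t f ^+ n.
Proof. by rewrite /pev rmorphXn horner_exp. Qed.

Lemma pev_sum t (I : finType) (f : I -> {poly k}) :
  pev t (\sum_i f i) = \sum_i pev t (f i).
Proof.
apply: (big_morph (pev t)); first exact: pevD.
by rewrite /pev rmorph0 horner0.
Qed.

Lemma pev_coef t (f : {poly k}) N : (size f <= N)%N ->
  pev t f = \sum_(s < N) j f`_s * t ^+ s.
Proof.
move=> sf; rewrite /pev (@horner_coef_wide _ N).
  by apply: eq_bigr => s _; rewrite coef_map.
by rewrite size_map_poly.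
Qed.

Definition transcendental (t : F) := forall f : {poly k}, f != 0 -> pev t f != 0.

Definition spanning (t : F) n (b : 'I_n -> F) := forall y : F,
  exists (d : {poly k}) (c : 'I_n -> {poly k}), d != 0 /\
    pev t d * y = \sum_i pev t (c i) * b i.

Section Lattice.
Variables (t : F) (n : nat) (b : 'I_n -> F).

(** Over [k] this is a space of dimension at most [n * N]; the counting argument
    compares this linear growth with that of the powers of a function [z]. *)
Definition lattice (N : nat) (y : F) := exists c : 'I_n -> {poly k},
  (forall i, (size (c i) <= N)%N) /\ y = \sum_i pev t (c i) * b i.

Lemma lattice_le M N y : (M <= N)%N -> lattice M y -> lattice N y.
Proof. by move=> MN [c [sc ->]]; exists c; split=> // i; apply: leq_trans MN. Qed.

Lemma lattice_sum N (I : finType) (y : I -> F) :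
  (forall i, lattice N (y i)) -> lattice N (\sum_i y i).
Proof.
move=> /choice[c cP]; exists (fun l => \sum_i c i l); split=> [l|].
  apply: (leq_trans (size_sum _ _ _)); apply/bigmax_leqP => i _.
  by case: (cP i).
rewrite (eq_bigr (fun i => \sum_l pev t (c i l) * b l)); last first.
  by move=> i _; case: (cP i).
rewrite exchange_big; apply: eq_bigr => l _ /=.
by rewrite pev_sum mulr_suml.
Qed.

Lemma lattice_pev N M (f : {poly k}) y : (size f <= M.+1)%N -> lattice N y ->
  lattice (N + M)%N (pev t f * y).
Proof.
move=> sf [c [sc ->]]; exists (fun i => f * c i); split=> [i|].
  apply: (leq_trans (size_polyMleq _ _)); have := sc i; lia.
by rewrite mulr_sumr; apply: eq_bigr => i _; rewrite pevM mulrA.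
Qed.

Lemma lattice_span N y : lattice N y ->
  kspan j [set 0] (fun u : 'I_n * 'I_N => t ^+ u.2 * b u.1 : F^o) y.
Proof.
move=> [c [sc ->]]; exists (fun u : 'I_n * 'I_N => (c u.1)`_u.2).
rewrite /kcomb -(pair_bigA _ (fun i (s : 'I_N) =>
  j (c i)`_s *: (t ^+ s * b i : F^o))) /=.
apply/eqP; rewrite subr_eq0; apply/eqP/eq_bigr => i _.
rewrite (pev_coef _ (sc i)) mulr_suml; apply: eq_bigr => s _.
by rewrite -mulrA.
Qed.

(** Once multiplied by [d], the multiplication by [z] shifts the index of
    [lattice] by at most [C]. *)
Definition mul_denom (z : F) (C : nat) (d : {poly k}) :=
  [/\ pev t d != 0, (size d <= C.+1)%N & forall l, lattice C.+1 (pev t d * z * b l)].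

Lemma lattice_denom N C z d y : mul_denom z C d -> lattice N y ->
  lattice (N + C)%N (pev t d * z * y).
Proof.
move=> [_ _ dz] [c [sc ->]]; rewrite mulr_sumr.
apply: lattice_sum => i; case: (dz i) => e [se eE].
rewrite mulrCA eE; exists (fun l => c i * e l); split=> [l|].
  apply: (leq_trans (size_polyMleq _ _)); have := sc i; have := se l; lia.
by rewrite mulr_sumr; apply: eq_bigr => l _; rewrite pevM mulrA.
Qed.

Lemma lattice_denomX N C z d y M s : mul_denom z C d -> lattice N y ->
  (s <= M)%N -> lattice (N + M * C)%N (pev t d ^+ M * (z ^+ s * y)).
Proof.
move=> dz; have [_ sd _] := dz.
elim: M s => [|M IHM] s yN sM.
  by move: sM; rewrite leqn0 => /eqP->; rewrite mul0n addn0 !expr0 !mul1r.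
rewrite mulSn [(C + _)%N]addnC addnA.
case: s sM => [_|s sM].
  have := lattice_pev sd (IHM 0%N yN (leq0n M)).
  by rewrite !expr0 !mul1r exprS mulrA.
have := lattice_denom dz (IHM s yN sM).
by congr lattice; rewrite !exprS; ring.
Qed.

Hypothesis t_tr : transcendental t.
Hypothesis b_span : spanning t b.

Lemma common_denominator (I : finType) (y : I -> F) :
  exists (d : {poly k}) N, d != 0 /\ forall i, lattice N (pev t d * y i).
Proof.
have /choice[d dP] : forall i, exists d : {poly k}, d != 0 /\ exists N, lattice N (pev t d * y i).
  move=> i; have [d [c [d0 dE]]] := b_span (y i); exists d; split=> //.
  exists (\max_l size (c l))%N, c; split=> // l.
  exact: (leq_bigmax l).
have /choice[N NP] : forall i, exists N, lattice N (pev t (\prod_i d i) * y i).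
  move=> i; have [_ [N dN]] := dP i; exists (N + size (\prod_(l | l != i) d l)%R)%N.
  rewrite [X in pev t X](bigD1 i) //= pevM [_ * pev _ _]mulrC -mulrA.
  exact: lattice_pev (leqnSn _) dN.
exists (\prod_i d i), (\max_i N i)%N; split=> [|i].
  by rewrite prodf_seq_neq0; apply/allP => i _; case: (dP i).
by apply: lattice_le (NP i); apply: (leq_bigmax i).
Qed.

Lemma mul_denom_ex z : exists C d, mul_denom z C d.
Proof.
have [d [N [d0 dN]]] := common_denominator (fun l => z * b l).
exists (maxn N (size d)), d; split; first exact: t_tr.
  by rewrite leqW // leq_maxr.
move=> l; rewrite -mulrA; apply: lattice_le (dN l).
by rewrite leqW // leq_maxl.
Qed.

Definition scaled (z : F) (B : set F^o) : set F^o := [set a | B (z^-1 * a)].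

(** If [y] is free modulo [z B] then the [z ^+ s * y i] with [s < M] are free:
    the coefficients of the powers of [z] vanish one after the other, because a
    combination without constant term lies in [z B]. *)
Lemma kfree_mul_powers (B : set F^o) z (I : finType) (y : I -> F^o) M :
    ksubspace j B -> z != 0 -> (forall a, B a -> B (z * a)) ->
    (forall i, B (y i)) -> kfree j (scaled z B) y ->
  kfree j [set 0] (fun u : 'I_M * I => z ^+ u.1 * y u.2 : F^o).
Proof.
move=> sB z0 zB By yfree.
have main (c : nat -> I -> k) N : \sum_(s < N) z ^+ s * kcomb j (c s) y = 0 ->
    forall s, (s < N)%N -> forall i, c s i = 0.
  elim: N c => // N IHN c; rewrite big_ord_recl expr0 mul1r.
  under eq_bigr => s _ do rewrite exprS -mulrA.
  rewrite -mulr_sumr => sum0.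
  have c0 : forall i, c 0%N i = 0.
    apply: yfree; rewrite /scaled /=; move/eqP: sum0; rewrite addr_eq0 => /eqP->.
    rewrite mulrN mulKf //; apply: (ksubN sB); apply: (ksub_sum sB) => s _.
    have BX (e : nat) a : B a -> B (z ^+ e * a).
      by elim: e => [|e IHe] Ba; rewrite ?expr0 ?mul1r // exprS -mulrA; apply/zB/IHe.
    by apply: BX; apply: ksub_comb.
  move: sum0; rewrite (_ : kcomb j (c _) y = 0) ?add0r; last first.
    by rewrite /kcomb big1 // => i _; rewrite c0 rmorph0 scale0r.
  move=> /eqP; rewrite mulf_eq0 (negbTE z0) /= => /eqP/(IHN (c \o succn)) cS.
  by case.
move=> c c0 [s i] /=.
pose c' s' i' := if insub s' is Some s'' then c (s'' : 'I_M, i') else 0.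
have <- : c' s i = c (s, i) by rewrite /c' valK.
apply: (main c' M) => //; rewrite -[RHS]c0 /kcomb.
transitivity (\sum_(s < M) \sum_i j (c (s, i)) *: (z ^+ s * y i : F^o)); last first.
  by rewrite pair_bigA; apply: eq_bigr => -[].
apply: eq_bigr => s' _; rewrite mulr_sumr; apply: eq_bigr => i' _.
by rewrite /c' valK [LHS]mulrCA.
Qed.

(** The [M #|I|] elements [z ^+ s * y i] with [s < M] are free and lie, up to a
    common factor, in a space of dimension [n (N + M C)].  Letting [M] grow gives
    the bound; it replaces the degree of the field over [k(z)]. *)
Lemma kfree_mul_bound (B : set F^o) z C d (I : finType) (y : I -> F^o) :
    mul_denom z C d -> ksubspace j B -> z != 0 -> (forall a, B a -> B (z * a)) ->
    (forall i, B (y i)) -> kfree j (scaled z B) y ->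
  (#|I| <= n * C)%N.
Proof.
move=> dz sB z0 zB By yfree.
have [d0 [N [d00 dN]]] := common_denominator y.
(* with this M the inequality M #|I| <= n (N + M C) forces #|I| <= n C *)
pose M := (n * N).+1.
have e0 : pev t d ^+ M * pev t d0 != 0.
  by have [dn0 _ _] := dz; rewrite mulf_neq0 ?expf_neq0 //; exact: t_tr.
have s0 : ksubspace j ([set 0] : set F^o).
  by split=> // [u v -> ->|c u ->]; rewrite ?addr0 ?scaler0.
have free : kfree j [set 0] (fun u : 'I_M * I =>
    pev t d ^+ M * pev t d0 * (z ^+ u.1 * y u.2) : F^o).
  move=> c c0; apply: (kfree_mul_powers sB z0 zB By yfree (M := M)).
  apply: (mulfI e0); rewrite mulr0 -[RHS]c0 /kcomb mulr_sumr.
  by apply: eq_bigr => u _; rewrite [LHS]mulrCA.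
have := kfree_leq_kspan s0 free (e := fun u : 'I_n * 'I_(N + M * C) => t ^+ u.2 * b u.1 : F^o).
rewrite !card_prod !card_ord => /(_ _); rewrite /M => H.
have : ((n * N).+1 * #|I| <= n * (N + (n * N).+1 * C))%N.
  apply: H => -[s i] /=; apply: lattice_span.
  rewrite -mulrA [pev t d0 * _]mulrCA; apply: (lattice_denomX dz (dN i)).
  exact: ltnW.
by nia.
Qed.

End Lattice.
End Counting.

(** * Filtrations by divisors *)

Section Filtration.
Variables (k F : fieldType) (j : {rmorphism k -> F}).

Lemma vge_scaled (p : place j) n (z : F) : z != 0 ->
  scaled z (vge p n) = vge p (n + p z).
Proof.
move=> z0; apply/seteqP; split=> a; rewrite /scaled /=.
  by move/(vge_mulE p n a (invr_neq0 z0)); rewrite placevV opprK.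
by move=> na; apply/(vge_mulE p n a (invr_neq0 z0)); rewrite placevV opprK.
Qed.

Definition residue_dim (p : place j) := has_kdim j (vge p 0) (vge p 1) (degree p).

(** The successive quotients are one-dimensional over the residue field. *)
Lemma vge_kdim p (m : int) (n : nat) : residue_dim p ->
  has_kdim j (vge p m) (vge p (m + n%:Z)) (n * degree p).
Proof.
move=> resp; have step (i : int) : has_kdim j (vge p i) (vge p (i + 1)) (degree p).
  have [z z0 pz] := placev_onto p i.
  move: resp; move/(has_kdim_iso (phi := fun a : F^o => z * a : F^o)); apply.
  - by move=> c u v; rewrite mulrDr; congr (_ + _); apply: mulrCA.
  - exact: vge_subspace.
  - exact: vge_subspace.
  - by move=> a a0; apply/(vge_mulE _ _ _ z0); rewrite pz subrr.
  - by move=> a a0; apply/(vge_mulE _ _ _ z0); rewrite pz addrC addKr.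
  - by move=> a /(vge_mulE _ _ _ z0); rewrite pz addrC addKr.
  - exact: vge_subspace.
  - move=> a ai; exists (z^-1 * a); last by rewrite mulVKf // subrr; apply: vge0.
    by apply/(vge_mulE _ _ _ (invr_neq0 z0)); rewrite placevV pz opprK add0r.
elim: n => [|n IHn].
  by rewrite mul0n addr0; apply: has_kdim_refl; apply: vge_subspace.
rewrite mulSn addnC; apply: has_kdim_trans IHn _.
- exact: vge_subspace.
- exact: vge_subspace.
- by move=> a; apply: vge_le; lia.
- by move=> a; apply: vge_le; lia.
- by have := step (m + n%:Z); rewrite -addrA -PoszD addn1.
Qed.

Variables (V : lmodType F) (V0 : set V) (S : set (place j)).
Variable ev : place j -> V -> F^o.

(** This covers two situations: the field [F] at finitely many places, where [ev] is
    the identity and surjectivity onto the graded pieces is weak approximation, and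
    the adeles at all places, where it is obvious. *)
Definition filtration (D : place j -> int) : set V :=
  [set u | V0 u /\ forall p, S p -> vge p (- D p) (ev p u)].

Hypothesis sV0 : ksubspace j V0.
Hypothesis lev : forall p, linear (ev p).
Hypothesis residueS : forall p, S p -> residue_dim p.

Lemma evD p u v : ev p (u + v) = ev p u + ev p v.
Proof. by have := lev p 1 u v; rewrite !scale1r. Qed.

Lemma ev0 p : ev p 0 = 0.
Proof. by have /eqP := evD p 0 0; rewrite addr0 -subr_eq0 opprD addrA subrr sub0r oppr_eq0 => /eqP. Qed.

Lemma evZ p c u : ev p (c *: u) = c *: ev p u.
Proof. by have := lev p c u 0; rewrite ev0 !addr0. Qed.

Lemma filtration_subspace D : ksubspace j (filtration D).
Proof.
have [V00 V0D V0Z] := sV0; split.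
- by split=> // p _; rewrite ev0; apply: vge0.
- move=> u v [Vu Du] [Vv Dv]; split; first exact: V0D.
  by move=> p Sp; rewrite evD; apply: vgeD; [apply: Du | apply: Dv].
- move=> c u [Vu Du]; split; first exact: V0Z.
  move=> p Sp; rewrite evZ; have [_ _ vZ] := vge_subspace p (- D p).
  exact/vZ/Du.
Qed.

Lemma filtration_le D D' : (forall p, S p -> D p <= D' p) ->
  filtration D `<=` filtration D'.
Proof.
move=> DD' u [Vu Du]; split=> // p Sp; apply: vge_le (Du p Sp).
by rewrite lerN2; apply: DD'.
Qed.

Hypothesis surj : forall p D a (m : int), S p -> vge p (- D p) a ->
  exists2 u, filtration D u & vge p m (a - ev p u).

Lemma filtration_kdim1 p D D' : S p -> D p <= D' p ->
  (forall q, q != p -> D q = D' q) ->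
  has_kdim j (filtration D') (filtration D) (`|D' p - D p| * degree p).
Proof.
move=> Sp Dp Dq.
have /(vge_kdim (- D' p) `|D' p - D p|) := residueS Sp.
rewrite gez0_abs ?subr_ge0 // addrA addNr add0r.
move/(has_kdim_iso (phi := ev p)); apply.
- exact: lev.
- exact: filtration_subspace.
- exact: vge_subspace.
- by move=> u [_]; apply.
- by move=> u [_]; apply.
- move=> u Dpu [Vu Du]; split=> // q Sq.
  by have [->//|/Dq->] := eqVneq q p; apply: Du.
- exact: filtration_subspace.
- by move=> a /(surj (- D p) Sp).
Qed.

(** The places of [s] are treated one at a time. *)
Lemma filtration_kdim D D' (s : seq (place j)) : uniq s ->
  (forall p, p \in s -> S p) -> (forall p, D p <= D' p) ->
  (forall p, p \notin s -> D p = D' p) ->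
  has_kdim j (filtration D') (filtration D)
    (\sum_(p <- s) `|D' p - D p| * degree p).
Proof.
elim: s D' => [|p s IHs] D' us sS DD' Ds.
  rewrite big_nil (_ : D' = D); last by apply/funext => p; rewrite Ds.
  exact: has_kdim_refl (filtration_subspace D).
have /andP[ps us'] := us.
pose D1 q := if q == p then D q else D' q.
rewrite big_cons; apply: (has_kdim_trans (C := filtration D1)).
- exact: filtration_subspace.
- exact: filtration_subspace.
- by apply: filtration_le => q _; rewrite /D1; case: eqP => // _; apply: DD'.
- by apply: filtration_le => q _; rewrite /D1; case: eqP => // _; apply: DD'.
- have -> : D p = D1 p by rewrite /D1 eqxx.
  apply: filtration_kdim1.
  + by apply: sS; rewrite inE eqxx.
  + by rewrite /D1 eqxx; apply: DD'.
  + by move=> q /negbTE qp; rewrite /D1 qp.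
- have -> : (\sum_(q <- s) `|(D' q - D q)%R| * degree q =
            \sum_(q <- s) `|(D1 q - D q)%R| * degree q)%N.
    rewrite big_seq [RHS]big_seq; apply: eq_bigr => q qs.
    by rewrite /D1; case: eqP ps qs => // -> /negP.
  apply: IHs => // q; rewrite /D1.
  + by move=> qs; apply: sS; rewrite inE qs orbT.
  + by case: eqP => // _; apply: DD'.
  + by move=> qs; case: eqP => // /eqP qp; apply: Ds; rewrite inE negb_or qp.
Qed.

End Filtration.

(** * Zeros of functions *)

Section FunctionField.
Variables (k F : fieldType) (j : {rmorphism k -> F}).

Definition independent (t : F) n (b : 'I_n -> F) :=
  forall c : 'I_n -> {poly k}, \sum_i pev j t (c i) * b i = 0 -> forall i, c i = 0.

(** A spanning family of minimal size is free: a relation would allow to eliminate one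
    of its members. *)
Lemma function_field_basis : function_field j ->
  exists t n (b : 'I_n -> F),
    [/\ transcendental j t, spanning j t b & independent t b].
Proof.
move=> [t tr [n0 [b0 b0P]]].
have t_tr : transcendental j t.
  by move=> f f0; apply/eqP => tf; apply: tr; exists f => //; apply/rootP.
pose P n := `[< exists b : 'I_n -> F, spanning j t b >].
have [n /asboolP[b bP] nmin] := ex_minnP (ex_intro P n0 (asboolT (ex_intro _ b0 b0P))).
exists t, n, b; split=> // c c0 i0; apply: contrapT => /eqP ci0.
suff /nmin : P n.-1 by case: n i0 {b bP nmin c c0 ci0} => [[]|n] //= _; rewrite ltnn.
apply/asboolP; exists (fun l => b (lift i0 l)) => y.
have [d [e [d0 dE]]] := bP y.
exists (c i0 * d), (fun l => c i0 * e (lift i0 l) - e i0 * c (lift i0 l)).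
rewrite mulf_neq0 // pevM -mulrA dE; split=> //.
move: c0; rewrite (bigD1_ord i0) //= => /eqP; rewrite addr_eq0 => /eqP c0.
rewrite (bigD1_ord i0) //= mulrDr mulrCA c0 mulrN !mulr_sumr -sumrN -big_split /=.
apply: eq_bigr => l _; rewrite /pev rmorphB !rmorphM hornerD hornerN !hornerM; ring.
Qed.

(** That [N] depends only on [z] makes this the source of all finiteness statements:
    for the residue fields, for the number of zeros of [z], and for the quotients of
    the valuation rings that produce new places. *)
Lemma kfree_mul_bound_ex (z : F) : function_field j -> z != 0 ->
  exists N, forall (B : set F^o) (I : finType) (y : I -> F^o), ksubspace j B ->
    (forall a, B a -> B (z * a)) -> (forall i, B (y i)) ->
    kfree j (scaled z B) y -> (#|I| <= N)%N.
Proof.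
move=> /function_field_basis[t [n [b [t_tr b_span _]]]] z0.
have [C [d dP]] := mul_denom_ex t_tr b_span z.
exists (n * C)%N => B I y sB zB By yfree.
exact: (kfree_mul_bound t_tr b_span dP sB z0 zB By yfree).
Qed.

Hypothesis ffF : function_field j.

(** With [z] a uniformizer the residue field is the quotient [B / z B] for [B] the
    local ring. *)
Lemma residueP (p : place j) : residue_dim p /\ (0 < degree p)%N.
Proof.
have [z z0 pz] := uniformizer p.
have [N NP] := kfree_mul_bound_ex ffF z0.
have [] := @has_kdim_bounded _ _ j _ (vge p 0) (vge p 1) N.
- exact: vge_subspace.
- exact: vge_subspace.
- move=> m y y0 yfree; rewrite -[m]card_ord; apply: (NP (vge p 0) _ y) y0 _.
  + exact: vge_subspace.
  + by move=> a a0; apply/(vge_mulE _ _ _ z0); apply: vge_le a0; rewrite pz.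
  + by rewrite (vge_scaled p 0 z0) pz add0r.
move=> m _ dm.
have degE : degree p = m.
  by rewrite /degree local_ringE max_idealE; apply: kdimE (vge_subspace p 1) dm.
rewrite /residue_dim degE; split=> //; rewrite lt0n; apply/eqP => m0.
move: dm; rewrite m0 => /(has_kdim0P (vge_subspace p 1)).
by move/(_ 1); rewrite !vgeE ?oner_eq0 // placev1 ler10 => /(_ (lexx _)).
Qed.

Lemma residue_kdim (p : place j) : residue_dim p. Proof. by case: (residueP p). Qed.
Lemma degree_gt0 (p : place j) : (0 < degree p)%N. Proof. by case: (residueP p). Qed.

(** The filtration of [F] at finitely many places: weak approximation says that
    its steps are as large as the residue fields. *)
Definition semilocal (s : seq (place j)) (D : place j -> int) : set F^o :=
  filtration (setT : set F^o) [set` s] (fun=> id) D.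

Lemma semilocal_subspace s D : ksubspace j (semilocal s D).
Proof. by apply: filtration_subspace. Qed.

Lemma semilocal_kdim s D D' : uniq s ->
  (forall p, D p <= D' p) -> (forall p, p \notin s -> D p = D' p) ->
  has_kdim j (semilocal s D') (semilocal s D)
    (\sum_(p <- s) `|D' p - D p| * degree p).
Proof.
move=> us DD' Ds; apply: filtration_kdim => //.
- by move=> p _; apply: residue_kdim.
- move=> p D1 a m /= ps aD1.
  have [y yP] := weak_approximation (fun q => if q == p then a else 0)
    (fun q => if q == p then Order.max m (- D1 p) else - D1 q) us.
  have yp := yP p ps; rewrite eqxx in yp.
  exists y; last first.
    by rewrite -opprB; apply: vgeN; apply: vge_le yp; rewrite le_max lexx.
  split=> // q qs; have := yP q qs; case: eqP => [->|_]; last by rewrite subr0.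
  move=> yp'; rewrite -[y](subrK a); apply: vgeD => //.
  by apply: vge_le yp'; rewrite le_max lexx orbT.
Qed.

(** The left hand side is the dimension of [B / z B] for [B] the semilocal ring of the
    places in [s]. *)
Lemma zeros_degree_le t n (b : 'I_n -> F) z C d (s : seq (place j)) :
  transcendental j t -> spanning j t b -> mul_denom j t b z C d -> z != 0 ->
  uniq s -> (forall p, p \in s -> 0 <= p z) ->
  (\sum_(p <- s) `|p z| * degree p <= n * C)%N.
Proof.
move=> t_tr b_span dz z0 us sz.
pose D (p : place j) : int := if p \in s then - p z else 0.
pose N := (\sum_(p <- s) `|(0 - D p)%R| * degree p)%N.
have kd : has_kdim j (semilocal s (fun=> 0)) (semilocal s D) N.
  apply: semilocal_kdim => // p; rewrite /D; last by move/negbTE->.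
  by case: ifP => // /sz; rewrite oppr_le0.
have -> : (\sum_(p <- s) `|p z| * degree p)%N = N.
  rewrite /N big_seq [RHS]big_seq; apply: eq_bigr => p ps.
  by rewrite /D ps sub0r opprK.
have [e [e0 efree _]] := has_kdim_basis (semilocal_subspace s D) kd.
rewrite -[N]card_ord.
apply: (kfree_mul_bound t_tr b_span dz (semilocal_subspace s (fun=> 0)) z0 _ e0).
  move=> a [_ a0]; split=> // p ps; apply/(vge_mulE _ _ _ z0).
  by apply: vge_le (a0 p ps); rewrite lerBlDr lerDl sz.
move=> c [_ c0]; apply: efree; split=> // p ps.
have : scaled z (vge p (- 0)) (kcomb j c e) by apply: c0.
by rewrite vge_scaled // /D ps opprK oppr0 add0r.
Qed.

(** Each zero contributes at least 1 to the sum bounded in [zeros_degree_le]. *)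
Lemma finite_zeros (z : F) : z != 0 -> finite_set [set p : place j | 0 < p z].
Proof.
move=> z0; have [t [n [b [t_tr b_span _]]]] := function_field_basis ffF.
have [C [d dz]] := mul_denom_ex t_tr b_span z.
apply: contrapT => /(infinite_set_fset (n * C).+1)[B BP]; apply/negP.
rewrite -ltnNge ltnS; have Bz p : p \in enum_fset B -> 0 < p z by apply: BP.
have := zeros_degree_le t_tr b_span dz z0 (fset_uniq B) (fun p pB => ltW (Bz p pB)).
apply: leq_trans; rewrite -sum1_size big_seq [leqRHS]big_seq.
apply: leq_sum => p /Bz pz; rewrite muln_gt0 degree_gt0 andbT absz_gt0.
by rewrite gt_eqF.
Qed.

Lemma finite_support (z : F) : finite_set [set p : place j | p z != 0].
Proof.
have [->|z0] := eqVneq z 0.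
  rewrite (_ : [set p | _] = set0); first exact: finite_set0.
  by apply/seteqP; split=> // p /=; rewrite placev0 eqxx.
apply: (@sub_finite_set _ _ ([set p : place j | 0 < p z] `|` [set p : place j | 0 < p z^-1])).
  move=> p /=; rewrite placevV oppr_gt0 => pz.
  by have [| |/eqP] := ltgtP (p z) 0; [right|left|rewrite (negbTE pz)].
by rewrite finite_setU; split; apply: finite_zeros; rewrite ?invr_eq0.
Qed.

End FunctionField.

(** * Existence of poles *)

Section Poles.
Variables (k F : fieldType) (j : {rmorphism k -> F}).
Implicit Types (O : set F^o) (y z : F).

Definition ksubring O : Prop :=
  [/\ forall c : k, O (j c), forall y z, O y -> O z -> O (y + z)
    & forall y z, O y -> O z -> O (y * z)].

Lemma subring_subspace O : ksubring O -> ksubspace j O.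
Proof.
move=> [Oc OD OM]; split=> //; first by rewrite -(rmorph0 j).
by move=> c u Ou; apply: OM.
Qed.

Lemma ksubring1 O : ksubring O -> O 1.
Proof. by case=> Oc _ _; rewrite -(rmorph1 j). Qed.

Lemma ksubringX O y n : ksubring O -> O y -> O (y ^+ n).
Proof.
move=> rO Oy; elim: n => [|n IHn]; first by rewrite expr0; apply: ksubring1.
by rewrite exprS; case: rO => _ _; apply.
Qed.

Definition adjoin O y : set F^o :=
  [set u | exists2 f : {poly F}, (forall i, O f`_i) & u = f.[y]].

Lemma adjoin_subring O y : ksubring O -> ksubring (adjoin O y).
Proof.
move=> rO; have [Oc OD OM] := rO; have sO := subring_subspace rO.
have O0 : O 0 by case: sO.
split=> [c|_ _ [f fO ->] [g gO ->]|_ _ [f fO ->] [g gO ->]].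
- exists (j c)%:P; last by rewrite hornerC.
  by move=> i; rewrite coefC; case: eqP.
- by exists (f + g); [move=> i; rewrite coefD; apply: OD | rewrite hornerD].
- exists (f * g); last by rewrite hornerM.
  by move=> i; rewrite coefM; apply: (ksub_sum sO) => l _; apply: OM.
Qed.

Lemma sub_adjoin O y : ksubring O -> O `<=` adjoin O y.
Proof.
move=> rO u Ou; exists u%:P; last by rewrite hornerC.
have [O0 _ _] := subring_subspace rO.
by move=> i; rewrite coefC; case: eqP.
Qed.

Lemma adjoin_gen O y : ksubring O -> adjoin O y y.
Proof.
move=> rO; exists 'X; last by rewrite hornerX.
have [O0 _ _] := subring_subspace rO.
by move=> i; rewrite coefX; case: eqP => _ //; apply: ksubring1.
Qed.

(** In a function field such an [O] is the valuation ring of a pole of [a]. *)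
Definition maximal_without (a : F) O : Prop :=
  [/\ ksubring O, O a^-1, ~ O a
    & forall O', ksubring O' -> O `<=` O' -> ~ O' a -> O' `<=` O].

(** Zorn's lemma, starting from [k[a^-1]], which does not contain the transcendental
    element [a]. *)
Lemma maximal_without_ex a : transcendental j a -> exists O, maximal_without a O.
Proof.
move=> a_tr; have a0 : a != 0.
  by have := a_tr 'X; rewrite polyX_eq0 /pev map_polyX hornerX; apply.
pose good (O : set F^o) := [/\ ksubring O, O a^-1 & ~ O a].
have goodU (C : set (set F^o)) : C !=set0 -> C `<=` good ->
    total_on C subset -> good (\bigcup_(X in C) X).
  move=> [X0 CX0] Cgood Ctot.
  have common y z : (\bigcup_(X in C) X) y -> (\bigcup_(X in C) X) z ->
      exists2 X, C X & X y /\ X z.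
    move=> [X CX Xy] [Z CZ Zz].
    by have [XZ|ZX] := Ctot X Z CX CZ; [exists Z | exists X] => //; split=> //; auto.
  split.
  - split=> [c|y z Uy Uz|y z Uy Uz].
    + by exists X0 => //; case: (Cgood _ CX0) => -[].
    + by have [X CX [Xy Xz]] := common y z Uy Uz; exists X => //;
        case: (Cgood _ CX) => -[_ XD _] _ _; apply: XD.
    + by have [X CX [Xy Xz]] := common y z Uy Uz; exists X => //;
        case: (Cgood _ CX) => -[_ _ XM] _ _; apply: XM.
  - by exists X0 => //; case: (Cgood _ CX0).
  - by move=> [X CX]; case: (Cgood _ CX).
(* the empty set is admitted because it is the union of the empty chain *)
have [|O [PO Omax]] := @Zorn_bigcup F^o [set X | X !=set0 -> good X].
  move=> C CP Ctot [u [X CX Xu]].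
  have -> : \bigcup_(X in C) X = \bigcup_(X in C `&` good) X.
    apply/seteqP; split=> y [Z CZ Zy]; exists Z => //; last by case: CZ.
    by split=> //; apply: (CP _ CZ); exists y.
  apply: goodU; first by exists X; split=> //; apply: (CP _ CX); exists u.
    by move=> Z [].
  by move=> Z1 Z2 [C1 _] [C2 _]; apply: Ctot.
have rk : ksubring [set u : F^o | exists f, u = pev j a^-1 f].
  split=> [c|_ _ [f ->] [g ->]|_ _ [f ->] [g ->]].
  - by exists c%:P; rewrite pevC.
  - by exists (f + g); rewrite pevD.
  - by exists (f * g); rewrite pevM.
have goodk : good [set u : F^o | exists f, u = pev j a^-1 f].
  split=> //; first by exists 'X; rewrite /pev map_polyX hornerX.
  (* multiplying a = f(a^-1) by a^N gives a relation of degree N + 1 for a *)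
  move=> [f fE]; pose N := size f.
  pose h := \poly_(i < N.+1) f`_(N - i).
  have : 'X^(N.+1) - h != 0.
    apply/eqP => /(congr1 (fun g : {poly k} => g`_N.+1)).
    rewrite coefB coefXn eqxx coef0 coef_poly ltnn subr0 => /eqP.
    by rewrite oner_eq0.
  move/a_tr/eqP; apply; rewrite /pev rmorphB hornerD hornerN.
  rewrite -!/(pev j a _) pevXn exprS {1}fE (pev_coef _ _ (leqnSn N)).
  rewrite (pev_coef _ _ (size_poly _ _)) mulr_suml (reindex_inj rev_ord_inj) /=.
  apply/eqP; rewrite subr_eq0; apply/eqP/eq_bigr => i _.
  have iN : (i <= N)%N by rewrite -ltnS.
  rewrite coef_poly ltn_ord subSS -mulrA; congr (_ * _).
  rewrite exprVn; apply: (mulIf (expf_neq0 (N - i) a0)).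
  by rewrite mulrAC mulVf ?expf_neq0 // mul1r -exprD subnKC.
have [O0|/set0P O0] := eqVneq O set0.
  exfalso; apply: (Omax [set u : F^o | exists f, u = pev j a^-1 f]); last by move=> _.
  split; first by rewrite O0.
  move=> sub; have : O 0 by apply: sub; exists 0; rewrite /pev rmorph0 horner0.
  by rewrite O0.
have [rO Oa nOa] := PO O0; exists O; split=> // O' rO' OO' nO'a.
apply: contrapT => nO'O; apply: (Omax O'); first by split.
by move=> _; split=> //; apply: OO'.
Qed.

Section MaximalSubring.
Variables (a : F) (O : set F^o).
Hypothesis Omax : maximal_without a O.

Let rO : ksubring O. Proof. by case: Omax. Qed.
Let sO : ksubspace j O. Proof. exact: subring_subspace. Qed.
Let OM y z : O y -> O z -> O (y * z). Proof. by case: rO => _ _; apply. Qed.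
Let OD y z : O y -> O z -> O (y + z). Proof. by case: rO => _ + _; apply. Qed.
Let nOa : ~ O a. Proof. by case: Omax. Qed.

Lemma max_pole_neq0 : a != 0.
Proof. by apply/eqP => a0; apply: nOa; rewrite a0; case: sO. Qed.

Let Oai : O a^-1. Proof. by case: Omax. Qed.

Lemma maximal_adjoin y : ~ O y -> adjoin O y a.
Proof.
move=> nOy; apply: contrapT => na; apply: nOy.
have [_ _ _ Om] := Omax; apply: (Om (adjoin O y)) => //.
- exact: adjoin_subring.
- exact: sub_adjoin.
- exact: adjoin_gen.
Qed.

(** In terms of [a^-1] this is the principal ideal that it generates in [O]. *)
Let I : set F^o := [set w | O (a * w)].

Let IO w : I w -> O w.
Proof. by move=> Iw; rewrite -[w](mulKf max_pole_neq0); apply: OM. Qed.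

Let IM y w : O y -> I w -> I (y * w).
Proof. by rewrite /I /= mulrCA => Oy Iw; apply: OM. Qed.

Let nI1 : ~ I 1. Proof. by rewrite /I /= mulr1. Qed.

Let unit1 w : I w -> 1 - w != 0.
Proof. by move=> Iw; apply/eqP => /eqP; rewrite subr_eq0 => /eqP w1; apply: nI1; rewrite w1. Qed.

(** Without its inverse in [O], [u = 1 - w] would satisfy [a = f.[u^-1]] with [f] over
    [O], whence [a u^N] in [O]; as [u^N] is 1 modulo the ideal generated by [a^-1],
    [a] would be in [O]. *)
Lemma maximal_unit w : O (a * w) -> O (1 - w)^-1.
Proof.
move=> Iw; apply: contrapT => /maximal_adjoin[f fO aE].
have u0 := unit1 Iw; set u := 1 - w in u0 aE.
have uX N : I (1 - u ^+ N).
  elim: N => [|N IHN]; first by rewrite expr0 subrr /I /= mulr0; case: sO.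
  have -> : 1 - u ^+ N.+1 = (1 - u ^+ N) + u ^+ N * w by rewrite /u exprS; ring.
  rewrite /I /= mulrDr; apply: OD => //; apply: IM => //; apply: ksubringX => //.
  by apply: (ksubB sO); [apply: ksubring1 | apply: IO].
have Ou : O u by apply: (ksubB sO); [apply: ksubring1 | apply: IO].
pose N := size f; have : O (a * u ^+ N).
  rewrite aE horner_coef mulr_suml; apply: (ksub_sum sO) => i _.
  rewrite -mulrA; apply: OM => //; rewrite exprVn.
  have -> : (u ^+ i)^-1 * u ^+ N = u ^+ (N - i).
    apply: (mulfI (expf_neq0 i u0)); rewrite mulVKf ?expf_neq0 // -exprD.
    by rewrite subnKC // ltnW.
  exact: ksubringX.
move=> OauN; apply: nOa.
have -> : a = a * u ^+ N + a * (1 - u ^+ N) by ring.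
by apply: OD => //; apply: uX.
Qed.

(** By maximality, [y] satisfies such a relation as soon as it is not in [O]. *)
Let rel y n := exists f : {poly F}, [/\ (size f <= n)%N, forall i, I f`_i & f.[y] = 1].

Let rel_ex y : ~ O y -> exists n, `[< rel y n >].
Proof.
move=> /maximal_adjoin[f fO aE]; exists (size f); apply/asboolP.
exists (a^-1 *: f); split; first exact: size_scale_leq.
  by move=> i; rewrite coefZ /I /= mulVKf // max_pole_neq0.
by rewrite hornerZ -aE mulVf // max_pole_neq0.
Qed.

(** The second relation, divided by [1 - g`_0], expresses the top term of the first
    one by lower terms. *)
Let rel_reduce y n m : y != 0 -> (m <= n)%N -> rel y n -> rel y^-1 m -> rel y n.-1.
Proof.
move=> y0 mn [f [sf fI f1]] [g [sg gI g1]].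
case: n mn sf => [|n] mn sf.
  move: sf; rewrite leqn0 size_poly_eq0 => /eqP f0.
  by move: f1; rewrite f0 horner0 => /eqP; rewrite eq_sym oner_eq0.
have sI : ksubspace j I.
  split; first by rewrite /I /= mulr0; case: sO.
    by move=> v w Iv Iw; rewrite /I /= mulrDr; apply: OD.
  by move=> c w Iw; apply: IM => //; case: rO.
have u0 := unit1 (gI 0%N).
have Ou : O (1 - g`_0)^-1 by apply: maximal_unit; apply: gI.
set u := 1 - g`_0 in u0 Ou.
have gE : \sum_(s < n) g`_(n - s) * y ^+ s = y ^+ n * u.
  have -> : u = g.[y^-1] - g`_0 by rewrite g1.
  rewrite (@horner_coef_wide _ n.+1); last exact: leq_trans sg mn.
  rewrite big_ord_recl expr0 mulr1 addrC addKr mulr_sumr.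
  rewrite (reindex_inj rev_ord_inj) /=; apply: eq_bigr => s _.
  rewrite /bump add1n (subKn (ltn_ord s)) mulrCA exprVn; congr (_ * _).
  apply: (mulIf (expf_neq0 s.+1 y0)); rewrite mulfVK ?expf_neq0 //.
  by rewrite -exprD subnK.
exists (\poly_(s < n) (f`_s + f`_n / u * g`_(n - s))); split=> [|i|].
- exact: size_poly.
- rewrite coef_poly; case: ifP => _; last by case: sI.
  have [_ ID _] := sI; apply: ID => //; apply: IM => //; apply: OM => //.
  exact/IO/fI.
- rewrite horner_poly.
  under eq_bigr => s _ do rewrite mulrDl -mulrA.
  rewrite big_split /= -mulr_sumr gE -f1 (@horner_coef_wide _ n.+1 f) //.
  rewrite big_ord_recr /=; congr (_ + _).
  by rewrite [y ^+ n * u]mulrC mulrA mulfVK.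
Qed.

(** Otherwise take relations of minimal degrees for [y] and for [y^-1]: the one of
    larger degree can be shortened by the other one. *)
Lemma maximal_valuation_ring y : ~ O y -> O y^-1.
Proof.
move=> nOy; apply: contrapT => nOyi.
have y0 : y != 0 by apply/eqP => y0; apply: nOy; rewrite y0; case: sO.
have [n /asboolP rn nmin] := ex_minnP (rel_ex nOy).
have [m /asboolP rm mmin] := ex_minnP (rel_ex nOyi).
have rel_gt0 z l : rel z l -> (0 < l)%N.
  case: l => // -[f [sf _]]; move: sf; rewrite leqn0 size_poly_eq0 => /eqP->.
  by rewrite horner0 => /eqP; rewrite eq_sym oner_eq0.
have [mn|nm] := leqP m n.
  have /asboolP/nmin := rel_reduce y0 mn rn rm.
  by have := rel_gt0 _ _ rn; case: (n) => //= l _; rewrite ltnn.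
have rn' : rel y^-1^-1 n by rewrite invrK.
have /asboolP/mmin := rel_reduce (invr_neq0 y0) (ltnW nm) rm rn'.
by have := rel_gt0 _ _ rm; case: (m) => //= l _; rewrite ltnn.
Qed.


(** The valuation is discrete because the quotients [O / y O] are finite dimensional
    over [k], with dimensions additive in [y]. *)
Section Discrete.
Hypothesis ffF : function_field j.

Let colength y := kdim j O (scaled y O).

Let scaledO_sub y : y != 0 -> ksubspace j (scaled y O).
Proof.
move=> y0; split; rewrite /scaled /=; first by rewrite mulr0; case: sO.
  by move=> u v Ou Ov; rewrite mulrDr; apply: OD.
by move=> c u Ou; rewrite -[j c *: u]/(j c * u) mulrCA; apply: OM => //; case: rO.
Qed.

Let colengthP y : O y -> y != 0 -> has_kdim j O (scaled y O) (colength y).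
Proof.
move=> Oy y0; have [N NP] := kfree_mul_bound_ex ffF y0.
have [n z Oz zfree|n _ dn] := has_kdim_bounded (N := N) sO (scaledO_sub y0).
  by rewrite -[n]card_ord; apply: (NP O _ z) => // u; apply: OM.
by rewrite /colength (kdimE (scaledO_sub y0) dn).
Qed.

Let colengthM y z : O y -> O z -> y != 0 -> z != 0 ->
  colength (y * z) = (colength y + colength z)%N.
Proof.
move=> Oy Oz y0 z0; have yz0 : y * z != 0 by rewrite mulf_neq0.
apply: kdimE; first exact: scaledO_sub.
apply: (has_kdim_trans (C := scaled y O)) (colengthP Oy y0) _.
- exact: scaledO_sub.
- exact: scaledO_sub.
- move=> u Ou; rewrite /scaled /=.
  have -> : y^-1 * u = z * ((y * z)^-1 * u) by field; rewrite y0 z0.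
  exact: OM.
- by move=> u; rewrite /scaled /= => Ou; rewrite -[u](mulVKf y0); apply: OM.
have := colengthP Oz z0.
move/(has_kdim_iso (phi := fun u : F^o => y * u : F^o)); apply.
- by move=> c u v; rewrite mulrDr; congr (_ + _); apply: mulrCA.
- exact: scaledO_sub.
- exact: scaledO_sub.
- by move=> u Ou; rewrite /scaled /= mulKf.
- by move=> u; rewrite /scaled /= invfM mulrAC mulKf // mulrC.
- by move=> u; rewrite /scaled /= invfM mulrAC mulKf // mulrC.
- exact: sO.
- move=> u Ou; exists (y^-1 * u) => //; rewrite mulVKf // subrr.
  by case: (scaledO_sub yz0).
Qed.

Let colength_unit y : O y -> y != 0 -> (colength y == 0%N) = `[< O y^-1 >].
Proof.
move=> Oy y0; have dy := colengthP Oy y0; apply/eqP/asboolP => [c0|Oyi].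
  rewrite c0 in dy; have := has_kdim0P (scaledO_sub y0) dy (ksubring1 rO).
  by rewrite /scaled /= mulr1.
apply: (has_kdim_uniq (scaledO_sub y0) dy).
suff -> : scaled y O = O by apply: has_kdim_refl.
apply/seteqP; split=> u; rewrite /scaled /=; last exact: OM.
by move=> Ou; rewrite -[u](mulVKf y0); apply: OM.
Qed.

(** A non-unit [u] of minimal colength divides every non-unit [y]: otherwise
    [u / y] would be a non-unit and the colength of [y] would be smaller. *)
Let uniformizer_ex : exists2 u : F, u != 0 /\ O u & ~ O u^-1 /\
  forall y, y != 0 -> O y -> ~ O y^-1 -> O (y / u).
Proof.
pose P n := `[< exists y, [/\ y != 0, O y, ~ O y^-1 & colength y = n] >].
have a0 := max_pole_neq0.
have exP : exists n, P n.
  exists (colength a^-1); apply/asboolP; exists a^-1.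
  by rewrite invr_eq0 invrK.
have [n /asboolP[u [u0 Ou nOu un]] nmin] := ex_minnP exP.
exists u => //; split=> // y y0 Oy nOy; apply: contrapT => nOyu.
have := maximal_valuation_ring nOyu; rewrite invf_div => Ouy.
have uy0 : u / y != 0 by rewrite mulf_neq0 ?invr_eq0.
have : colength u = (colength y + colength (u / y))%N.
  by rewrite -colengthM // mulrCA divff // mulr1.
have : (0 < colength (u / y))%N.
  rewrite lt0n colength_unit //; apply/asboolP; by rewrite invf_div.
have /nmin : P (colength y) by apply/asboolP; exists y.
rewrite un; lia.
Qed.

(** Every nonzero element is a unit times a power of the generator of the maximal
    ideal; the exponent is the valuation. *)
Lemma place_of_maximal : exists p : place j, p a < 0.
Proof.
have a0 := max_pole_neq0.
have [u [u0 Ou] [nOu umin]] := uniformizer_ex.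
pose unit y := O y /\ O y^-1.
have unitM y z : unit y -> unit z -> unit (y * z).
  by move=> [? ?] [? ?]; split; rewrite ?invfM; apply: OM.
have cu : (0 < colength u)%N.
  by rewrite lt0n colength_unit //; apply/asboolP.
have unitO y : y != 0 -> O y -> exists e : nat, unit (y / u ^+ e).
  move=> y0 Oy; have [n] := ubnP (colength y).
  elim: n y y0 Oy => // n IHn y y0 Oy; rewrite ltnS => yn.
  have [Oyi|nOyi] := pselect (O y^-1); first by exists 0%N; rewrite expr0 divr1.
  have Oyu := umin y y0 Oy nOyi.
  have yu0 : y / u != 0 by rewrite mulf_neq0 ?invr_eq0.
  have : colength y = (colength (y / u) + colength u)%N.
    by rewrite -colengthM // mulfVK.
  move=> cy; have [|e ue] := IHn (y / u) yu0 Oyu; first lia.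
  by exists e.+1; rewrite exprS invfM mulrA.
have unitF y : exists e : int, y != 0 -> unit (y / u ^ e).
  have [->|y0] := eqVneq y 0; first by exists 0.
  have [Oy|nOy] := pselect (O y).
    by have [e ye] := unitO y y0 Oy; exists e%:Z.
  have Oyi := maximal_valuation_ring nOy.
  have [e [ye1 ye2]] := unitO y^-1 (invr_neq0 y0) Oyi; exists (- e%:Z) => _.
  by split; rewrite -exprnN invrK; [rewrite -[_ * _]invrK invfM | rewrite invfM].
have [v vP] := choice unitF.
have unit_exp (e : int) : unit (u ^ e) -> e = 0.
  have key (n : nat) : ~ O (u ^- n.+1).
    move=> On; apply: nOu; have : O (u ^+ n * u ^- n.+1).
      by apply: OM => //; apply: ksubringX.
    by rewrite exprSr invfM mulVKf // expf_neq0.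
  case: e => [[|n]|n] // [On On']; exfalso; first exact: (key n).
  by apply: (key n); rewrite exprnN -NegzE.
have v_uniq y e : y != 0 -> unit (y / u ^ e) -> v y = e.
  move=> y0 [ye ye']; have [yv yv'] := vP y y0.
  apply/eqP; rewrite -subr_eq0; apply/eqP/unit_exp.
  have -> : u ^ (v y - e) = (y / u ^ e) * (y / u ^ v y)^-1.
    by rewrite expfzDr // -invr_expz; field; rewrite y0 !expfz_neq0.
  by split; [exact: OM | rewrite invfM invrK; apply: OM].
pose w y := if y == 0 then 0 else v y.
have wE y : y != 0 -> w y = v y by rewrite /w => /negbTE->.
have wP : normalized_valuation j w.
  have uz (e : int) : u ^ e != 0 by rewrite expfz_neq0.
  split.
  - by rewrite /w eqxx.
  - move=> c c0; have jc0 : j c != 0 by rewrite fmorph_eq0.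
    rewrite wE //; apply: v_uniq => //; rewrite expr0z divr1.
    by split; rewrite -?fmorphV; case: rO.
  - move=> y z y0 z0; rewrite !wE ?mulf_neq0 //; apply: v_uniq.
      by rewrite mulf_neq0.
    have := unitM _ _ (vP y y0) (vP z z0); congr unit.
    by rewrite expfzDr // invfM mulrACA.
  - suff main y z : y != 0 -> z != 0 -> y + z != 0 -> v y <= v z -> v y <= v (y + z).
      move=> y z y0 z0 yz0; rewrite !wE // ge_min.
      have [yz|/ltW zy] := leP (v y) (v z); first by rewrite main.
      by rewrite [y + z]addrC main ?orbT // addrC.
    move=> y0 z0 yz0 vyz; rewrite leNgt; apply/negP => lt.
    have [yv _] := vP y y0; have [zv _] := vP z z0.
    have [_ sv] := vP _ yz0.
    have Oue (e : int) : 0 <= e -> O (u ^ e) by case: e => // e _; apply: ksubringX.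
    have Os : O ((y + z) / u ^ v y).
      rewrite mulrDl; apply: OD => //.
      have -> : z / u ^ v y = z / u ^ v z * u ^ (v z - v y).
        by rewrite expfzDr // -invr_expz mulrA mulfVK.
      by apply: OM => //; apply: Oue; rewrite subr_ge0.
    have Ou1 : O (u ^ (v (y + z) - v y)).
      have -> : u ^ (v (y + z) - v y) = (y + z) / u ^ v y * ((y + z) / u ^ v (y + z))^-1.
        by rewrite expfzDr // -invr_expz; field; rewrite yz0 !uz.
      exact: OM.
    have : unit (u ^ (v (y + z) - v y)).
      by split=> //; rewrite invr_expz; apply: Oue; rewrite opprB subr_ge0 ltW.
    by move/unit_exp => /eqP; rewrite subr_eq0 lt_eqF.
  - exists u; rewrite wE //; apply: v_uniq => //; rewrite expr1z divff //.
    by split; rewrite ?invr1; apply: ksubring1.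
exists (Place wP) => /=; rewrite wE //; rewrite ltNge; apply/negP => va.
have [Oav _] := vP a a0; apply: nOa; rewrite -[a](mulfVK (expfz_neq0 (v a) u0)).
by apply: OM => //; case: (v a) va => // e _; apply: ksubringX.
Qed.

End Discrete.
End MaximalSubring.

(** Existence of places in the manner of Chevalley: a subring which is maximal without
    [a] is the valuation ring of a place, where [a^-1] is not a unit. *)
Theorem pole_ex (a : F) : function_field j -> transcendental j a ->
  exists p : place j, p a < 0.
Proof.
by move=> ffF /maximal_without_ex[O Omax]; apply: place_of_maximal Omax ffF.
Qed.

End Poles.

(** * Riemann's inequality *)

Section Riemann.
Variables (k F : fieldType) (j : {rmorphism k -> F}).
Hypothesis ffF : function_field j.
Implicit Types (D : place j -> int) (p : place j).

Definition divisor D := exists s : seq (place j), forall p, p \notin s -> D p = 0.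

Definition div_degree D : int :=
  \sum_(p \in [set: place j]) D p * (degree p)%:Z.

Lemma div_degreeE D (s : seq (place j)) : uniq s -> (forall p, p \notin s -> D p = 0) ->
  div_degree D = \sum_(p <- s) D p * (degree p)%:Z.
Proof.
move=> us Ds; rewrite /div_degree (fsbigE s) //.
  by apply: eq_bigl => p; rewrite in_setT.
by move=> p _ /Ds->; rewrite mul0r.
Qed.

Lemma common_support D D' : divisor D -> divisor D' ->
  exists s : seq (place j), [/\ uniq s, forall p, p \notin s -> D p = 0
    & forall p, p \notin s -> D' p = 0].
Proof.
move=> [s sP] [s' s'P]; exists (undup (s ++ s')); split; first exact: undup_uniq.
  by move=> p; rewrite mem_undup mem_cat negb_or => /andP[/sP].
by move=> p; rewrite mem_undup mem_cat negb_or => /andP[_ /s'P].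
Qed.

Lemma divisor_map2 D D' (f : int -> int -> int) : f 0 0 = 0 ->
  divisor D -> divisor D' -> divisor (fun p => f (D p) (D' p)).
Proof.
move=> f0 fD fD'; have [s [_ sD sD']] := common_support fD fD'.
by exists s => p ps; rewrite sD // sD'.
Qed.

Lemma divisor0 : divisor (fun=> 0). Proof. by exists [::]. Qed.

Lemma divisor_principal z : divisor (fun p => p z).
Proof.
have fin := @finite_support _ _ j ffF z; exists (fset_set [set p : place j | p z != 0]).
move=> p; rewrite in_fset_set // notin_setE /= => /negP; rewrite negbK.
exact/eqP.
Qed.

Lemma div_degree_lin D D' (a b : int) : divisor D -> divisor D' ->
  div_degree (fun p => a * D p + b * D' p) = a * div_degree D + b * div_degree D'.
Proof.
move=> fD fD'; have [s [us sD sD']] := common_support fD fD'.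
rewrite !(div_degreeE us) //; last by move=> p ps; rewrite sD // sD' // !mulr0.
rewrite !mulr_sumr -big_split; apply: eq_bigr => p _ /=; ring.
Qed.

Lemma div_degree_diff D D' (s : seq (place j)) : uniq s ->
  (forall p, p \notin s -> D p = 0) -> (forall p, p \notin s -> D' p = 0) ->
  (forall p, D p <= D' p) ->
  (\sum_(p <- s) `|(D' p - D p)%R| * degree p)%N%:Z = div_degree D' - div_degree D.
Proof.
move=> us sD sD' DD'; rewrite !(div_degreeE us) // -sumrB.
rewrite (big_morph Posz PoszD (erefl 0%:Z)); apply: eq_bigr => p _.
by rewrite PoszM gez0_abs ?subr_ge0 // mulrBl.
Qed.

(** The Riemann-Roch space of the divisor [D]. *)
Definition Lspace D : set F^o := [set a | forall p, vge p (- D p) a].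

Lemma Lspace_subspace D : ksubspace j (Lspace D).
Proof.
split=> [p|u v uD vD p|c u uD p]; first exact: vge0.
  by apply: vgeD.
by have [_ _ vZ] := vge_subspace p (- D p); apply: vZ.
Qed.

Lemma zero_subspace (V : lmodType F) : @ksubspace k F j V [set 0].
Proof. by split=> // [u v -> ->|c u ->]; rewrite ?addr0 ?scaler0. Qed.

Lemma Lspace_le D D' : (forall p, D p <= D' p) -> Lspace D `<=` Lspace D'.
Proof. by move=> DD' a aD p; apply: vge_le (aD p); rewrite lerN2. Qed.

(** The quotient embeds into the quotient of two steps of the semilocal filtration at
    the places of the supports. *)
Lemma Lspace_step D D' : divisor D -> divisor D' -> (forall p, D p <= D' p) ->
  exists2 m : nat, has_kdim j (Lspace D') (Lspace D) m
    & m%:Z <= div_degree D' - div_degree D.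
Proof.
move=> fD fD' DD'; have [s [us sD sD']] := common_support fD fD'.
have Ds p : p \notin s -> D p = D' p by move=> ps; rewrite sD // sD'.
have kd := semilocal_kdim ffF us DD' Ds.
rewrite -(div_degree_diff us sD sD' DD').
have [n b bD' bfree|m mN dm] := has_kdim_bounded (N := (\sum_(p <- s) `|(D' p - D p)%R| * degree p)%N)
  (Lspace_subspace D') (Lspace_subspace D); last by exists m.
rewrite -[n]card_ord; apply: kfree_leq_kdim (semilocal_subspace s D) kd _ _.
  move=> c [_ cD]; apply: bfree => p.
  have [ps|ps] := boolP (p \in s); first exact: cD.
  by rewrite Ds //; apply: (ksub_comb c (Lspace_subspace D') bD').
by move=> i; split=> // p _; apply: bD'.
Qed.

(** A function [a] without poles is algebraic over [k], hence a unit at every place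
    unless it vanishes; so these functions embed into any residue field. *)
Lemma Lspace0_finite : exists m : nat, has_kdim j (Lspace (fun=> 0)) [set 0] m.
Proof.
have [t [n [b [t_tr _ _]]]] := function_field_basis ffF.
have [p _] := pole_ex ffF t_tr.
have inj a : Lspace (fun=> 0) a -> vge p 1 a -> a = 0.
  move=> a0 pa; apply: contrapT => /eqP nz.
  have [f f0 fa] : exists2 f : {poly k}, f != 0 & pev j a f = 0.
    apply: contrapT => no; have [|q qa] := @pole_ex _ _ j a ffF.
      by move=> f f0; apply/eqP => fa; apply: no; exists f.
    by have := a0 q; rewrite vgeE // oppr0 leNgt qa.
  have key (h : {poly k}) : h != 0 -> pev j a h != 0.
    elim/poly_ind: h => [|h c IH]; first by rewrite eqxx.
    rewrite pevD pevM pevC /pev map_polyX hornerX -/(pev j a h) => hc0.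
    have [c0|c0] := eqVneq c 0.
      rewrite c0 rmorph0 addr0 mulf_neq0 // IH //.
      by apply: contra_neq hc0 => ->; rewrite c0 mul0r addr0.
    rewrite addrC; have [] // := @placevD_lt _ _ j p (j c) (pev j a h * a).
      by rewrite fmorph_eq0.
    have [->|ha0] := eqVneq (pev j a h) 0; first by rewrite mul0r eqxx.
    rewrite placev_const mulf_eq0 (negbTE nz) (negbTE ha0) /= placevM //.
    have h0 : vge p 0 (pev j a h).
      rewrite (pev_coef j a (leqnn _)); apply: (ksub_sum (vge_subspace p 0)) => s _.
      have [_ _ vZ] := vge_subspace p 0; apply: vZ.
      have ps : vge p 0 a by apply: vge_le pa.
      elim: (s : nat) => [|e IHe]; first by rewrite expr0 vgeE ?oner_neq0 // placev1.
      by rewrite exprS -[0]addr0; apply: vgeM.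
    by move: h0 pa; rewrite !vgeE // => h0 pa; rewrite ltr_wpDl // gtz0_ge1.
  by move/eqP: fa; apply/negP/key.
have [m c c0 cfree|m _ dm] := has_kdim_bounded (N := degree p)
  (Lspace_subspace (fun=> 0)) (zero_subspace _); last by exists m.
rewrite -[m]card_ord; apply: (kfree_leq_kdim (b := c) (vge_subspace p 1) (residue_kdim ffF p)).
  move=> d dp; apply: cfree; apply: inj => //.
  exact: (ksub_comb d (Lspace_subspace _) c0).
by move=> i; have := c0 i p; rewrite oppr0.
Qed.

Lemma Lspace_finite D : divisor D -> exists m : nat, has_kdim j (Lspace D) [set 0] m.
Proof.
move=> fD; pose D' p := Order.max (D p) 0.
have fD' : divisor D' by apply: (divisor_map2 (f := Order.max)) fD divisor0.
have D'0 p : 0 <= D' p by rewrite le_max lexx orbT.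
have [m dm _] := Lspace_step divisor0 fD' D'0.
have [m0 dm0] := Lspace0_finite.
have zsub : [set 0] `<=` Lspace (fun=> 0) by move=> a ->; case: (Lspace_subspace (fun=> 0)).
have dD' := has_kdim_trans (Lspace_subspace _) (zero_subspace _) zsub (Lspace_le D'0) dm dm0.
have [||_ [m2 [_ d2 _]]] := has_kdim_split (Lspace_subspace _) (Lspace_subspace D) (zero_subspace _) _ _ dD'.
- by move=> a ->; case: (Lspace_subspace D).
- by apply: Lspace_le => p; rewrite le_max lexx.
- by exists m2.
Qed.

Definition ell D : nat := kdim j (Lspace D) [set 0].

Lemma ellP D : divisor D -> has_kdim j (Lspace D) [set 0] (ell D).
Proof.
move=> /Lspace_finite[m dm].
by rewrite /ell (kdimE (zero_subspace _) dm).
Qed.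

(** The quotient of the two spaces has at most the dimension [div_degree D' -
    div_degree D], so that the defect [div_degree D - ell D] is monotone. *)
Lemma ell_step D D' : divisor D -> divisor D' -> (forall p, D p <= D' p) ->
  exists m, [/\ has_kdim j (Lspace D') (Lspace D) m, ell D' = (m + ell D)%N
    & div_degree D - (ell D)%:Z <= div_degree D' - (ell D')%:Z].
Proof.
move=> fD fD' DD'; have [m dm mle] := Lspace_step fD fD' DD'; exists m.
have d' : has_kdim j (Lspace D') [set 0] (m + ell D).
  apply: has_kdim_trans dm (ellP fD); first exact: Lspace_subspace.
  - exact: zero_subspace.
  - by move=> a ->; case: (Lspace_subspace D).
  - exact: Lspace_le.
have e : ell D' = (m + ell D)%N by apply: kdimE d'; apply: zero_subspace.
split=> //; rewrite e PoszD; move: mle; lia.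
Qed.

Lemma ell_mul D z : divisor D -> z != 0 -> ell (fun p => D p - p z) = ell D.
Proof.
move=> fD z0; apply: kdimE; first exact: zero_subspace.
move: (ellP fD); move/(has_kdim_iso (phi := fun a : F^o => z * a : F^o)); apply.
- by move=> c u v; rewrite mulrDr; congr (_ + _); apply: mulrCA.
- exact: zero_subspace.
- exact: zero_subspace.
- move=> a aD p; apply/(vge_mulE _ _ _ z0); apply: vge_le (aD p); lia.
- by move=> a ->; rewrite mulr0.
- by move=> a /eqP; rewrite mulf_eq0 (negbTE z0) => /eqP.
- exact: Lspace_subspace.
- move=> a aD; exists (z^-1 * a); last by rewrite mulVKf // subrr.
  move=> p; apply/(vge_mulE _ _ _ (invr_neq0 z0)).
  by apply: vge_le (aD p); rewrite placevV; lia.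
Qed.

Lemma ell_free D (I : finType) (b : I -> F^o) : divisor D ->
  kfree j [set 0] b -> (forall i, Lspace D (b i)) -> (#|I| <= ell D)%N.
Proof. by move=> fD; apply: (kfree_leq_kdim (zero_subspace _) (ellP fD)). Qed.

Section Bound.
Variables (t : F) (n : nat) (b : 'I_n -> F).
Hypotheses (t_tr : transcendental j t) (b_span : spanning j t b).
Hypothesis b_indep : independent j t b.

Let t_neq0 : t != 0.
Proof.
have := t_tr (f := 'X); rewrite /pev map_polyX hornerX polyX_eq0; exact.
Qed.

Let vge_pev p (f : {poly k}) : 0 <= p t -> vge p 0 (pev j t f).
Proof.
move=> pt; rewrite (pev_coef j t (leqnn _)); apply: (ksub_sum (vge_subspace p 0)) => s _.
have [_ _ vZ] := vge_subspace p 0; apply: vZ.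
by rewrite vgeE ?expf_neq0 // placevX mulrn_wge0.
Qed.

(** At a pole of [t] the leading term dominates. *)
Lemma pev_pole p (f : {poly k}) : p t < 0 -> f != 0 ->
  p (pev j t f) = p t * (size f).-1.
Proof.
move=> pt f0; case sE : (size f) => [|d].
  by move/eqP: sE; rewrite size_poly_eq0 (negbTE f0).
have fd : f`_d != 0 by have := lead_coef_eq0 f; rewrite /lead_coef sE (negbTE f0) => ->.
have pd : p (j f`_d * t ^+ d) = p t * d.
  rewrite placevM ?fmorph_eq0 ?expf_neq0 // placev_const add0r placevX.
  by rewrite -mulr_natr natz.
rewrite (pev_coef j t (leqnn _)) sE big_ord_recr /= addrC.
set rest := \sum_(i < d) _.
have restP : vge p (p t * d + 1) rest.
  apply: (ksub_sum (vge_subspace p _)) => i _.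
  have [_ _ vZ] := vge_subspace p (p t * d + 1); apply: vZ.
  rewrite vgeE ?expf_neq0 // placevX -mulr_natr natz.
  have := ltn_ord i; nia.
have [] := @placevD_lt _ _ j p (j f`_d * t ^+ d) rest.
- by rewrite mulf_neq0 ?fmorph_eq0 ?expf_neq0.
- by rewrite pd; move: restP; rewrite /vge /= -ltzD1 ltrD2r.
- by rewrite pd => _ ->.
Qed.

(** The residue field at [p] is finite dimensional, so the powers of [t] satisfy a
    linear relation in it. *)
Lemma poly_vanishing1 p : 0 <= p t -> exists2 f : {poly k}, f != 0 & 0 < p (pev j t f).
Proof.
move=> pt; pose y (s : 'I_(degree p).+1) : F^o := t ^+ s.
have y0 s : vge p 0 (y s) by rewrite vgeE ?expf_neq0 // placevX mulrn_wge0.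
have [c [cy c0]] : exists c : 'I_(degree p).+1 -> k, vge p 1 (kcomb j c y) /\ ~ (forall s, c s = 0).
  apply: contrapT => no.
  have := @kfree_leq_kdim _ _ j _ _ _ _ _ y (vge_subspace p 1) (residue_kdim ffF p) _ y0.
  rewrite card_ord ltnn; case/(_ _)/notP => // c cy; apply: contrapT => c0.
  by apply: no; exists c.
pose f := \poly_(s < (degree p).+1) c (inord s).
have f0 : f != 0.
  apply/eqP => f0; apply: c0 => s.
  have := congr1 (fun g : {poly k} => g`_s) f0.
  by rewrite coef_poly ltn_ord coef0 inord_val.
exists f => //; move: cy; rewrite (_ : kcomb j c y = pev j t f).
  by rewrite vgeE ?t_tr // gtz0_ge1.
rewrite (pev_coef j t (size_poly _ _)); apply: eq_bigr => s _.
by rewrite coef_poly ltn_ord inord_val.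
Qed.

Lemma poly_vanishing D : divisor D ->
  exists2 f : {poly k}, f != 0 & forall p, 0 <= p t -> D p <= p (pev j t f).
Proof.
have ge0 p (f : {poly k}) : f != 0 -> 0 <= p t -> 0 <= p (pev j t f).
  by move=> f0 /(vge_pev f); rewrite vgeE ?t_tr.
move=> [s sP]; suff [f f0 fP] : exists2 f : {poly k}, f != 0 &
    forall p, p \in s -> 0 <= p t -> D p <= p (pev j t f).
  exists f => // p pt; have [ps|ps] := boolP (p \in s); first exact: fP.
  by rewrite sP // ge0.
elim: s {sP} => [|q s [f f0 fP]]; first by exists 1; rewrite ?oner_eq0.
have [qt|qt] := lerP 0 (q t); last first.
  exists f => // p; rewrite inE => /orP[/eqP->|]; last exact: fP.
  by rewrite leNgt qt.
have [h h0 hq] := poly_vanishing1 qt.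
exists (f * h ^+ `|D q|); first by rewrite mulf_neq0 ?expf_neq0.
move=> p ps pt; rewrite pevM pevX placevM ?expf_neq0 ?t_tr // placevX.
have := ge0 p f f0 pt; have := ge0 p h h0 pt; rewrite -mulr_natr.
move: ps; rewrite inE => /orP[/eqP->|ps]; first by nia.
by have := fP p ps pt; nia.
Qed.

Definition poles p : int := Order.max 0 (- p t).

Lemma divisor_poles : divisor poles.
Proof.
apply: (divisor_map2 (f := fun _ x => Order.max 0 (- x))) divisor0 (divisor_principal t).
by rewrite oppr0 maxxx.
Qed.

(** The poles of [t] are the zeros of [t^-1], and the multiplication by [t^-1] has the
    denominator [t] of degree 1. *)
Lemma div_degree_poles : div_degree poles <= n.
Proof.
have [s0 sP0] := divisor_poles; pose s := undup s0.
have sP p : p \notin s -> poles p = 0 by rewrite mem_undup; apply: sP0.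
have us : uniq s by apply: undup_uniq.
have dt : mul_denom j t b t^-1 1 'X.
  split; rewrite ?t_tr ?polyX_eq0 ?size_polyX // => l.
  rewrite /pev map_polyX hornerX divff // mul1r.
  exists (fun i => (i == l)%:R); split=> [i|].
    by case: eqP => _; rewrite ?size_poly1 ?size_poly0.
  rewrite (bigD1 l) //= big1 => [|i /negbTE->]; rewrite ?eqxx ?pev1 ?mul1r ?addr0 //.
  by rewrite /pev rmorph0 horner0 mul0r.
have := zeros_degree_le ffF t_tr b_span dt (invr_neq0 t_neq0)
  (filter_uniq (fun p => p t < 0) us).
rewrite muln1 => /(_ _)/wrap[p|]; first by rewrite mem_filter placevV => /andP[? _]; lia.
rewrite (div_degreeE us sP) -lez_nat (big_morph Posz PoszD (erefl 0%:Z)) => le.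
apply: le_trans le; rewrite big_filter [leRHS]big_mkcond; apply: ler_sum => p _.
rewrite /poles; case: ltP => pt; last by rewrite max_l ?mul0r // oppr_le0.
have -> : Order.max 0 (- p t) = `|p t^-1|%:Z by rewrite placevV; lia.
by rewrite PoszM.
Qed.

(** The multiple of [poles] cancels the poles of [f(t)], so that only its zeros are
    left. *)
Lemma zeros_div_degree (f : {poly k}) : f != 0 ->
  div_degree (fun p => p (pev j t f) + (size f).-1%:Z * poles p) <= (n * (size f).-1)%:Z.
Proof.
move=> f0; set z := pev j t f; set d := (size f).-1.
have z0 : z != 0 by apply: t_tr.
pose D p := 1 * p z + d%:Z * poles p.
have fD : divisor D.
  by apply: (divisor_map2 (f := fun x y => 1 * x + d%:Z * y)) (divisor_principal z) divisor_poles; rewrite !mulr0.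
have [s0 sP0] := fD; pose s := undup s0.
have sP p : p \notin s -> D p = 0 by rewrite mem_undup; apply: sP0.
have us : uniq s by apply: undup_uniq.
have dz : mul_denom j t b z d 1.
  split; rewrite ?pev1 ?oner_eq0 ?size_poly1 // => l; rewrite mul1r.
  exists (fun i => f * (i == l)%:R); split=> [i|].
    by case: eqP => _; rewrite ?mulr1 ?mulr0 ?size_poly0 // /d leqSpred.
  rewrite (bigD1 l) //= big1 => [|i /negbTE->]; rewrite ?eqxx ?mulr1 ?addr0 //.
  by rewrite mulr0 /pev rmorph0 horner0 mul0r.
have := zeros_degree_le ffF t_tr b_span dz z0 (filter_uniq (fun p => 0 <= p t) us).
have zge p : 0 <= p t -> 0 <= p z by move=> /(vge_pev f); rewrite vgeE.
move=> /(_ _)/wrap[p|]; first by rewrite mem_filter => /andP[/zge].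
rewrite (_ : (fun p => _) = D); last by apply/funext => p; rewrite /D mul1r.
rewrite (div_degreeE us sP) -lez_nat (big_morph Posz PoszD (erefl 0%:Z)) => le.
apply: le_trans le; rewrite big_filter [leRHS]big_mkcond; apply: ler_sum => p _.
rewrite /D /poles; case: (boolP (0 <= p t)) => pt; last rewrite -ltNge in pt.
  by rewrite max_l ?oppr_le0 // mulr0 addr0 mul1r PoszM gez0_abs // zge.
rewrite max_r ?oppr_ge0 ?(ltW pt) // /z (pev_pole pt f0) -/d.
by rewrite (_ : 1 * _ + _ = 0) ?mul0r //; ring.
Qed.

(** The [t ^+ s * b i] with [s < r] are free over [k], and up to a common factor they
    have no other poles than those of [t], of controlled order. *)
Lemma ell_poles : exists c : nat, forall r : nat,
  (n * r)%:Z <= (ell (fun p => (c + r)%:Z * poles p))%:Z.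
Proof.
have fabs (I : finType) (y : I -> F) : divisor (fun p => \sum_i `|p (y i)|).
  have /choice[s sP] i := divisor_principal (y i).
  exists (flatten [seq s i | i : I]) => p ps; rewrite big1 // => i _.
  rewrite sP ?normr0 //; apply: contra ps => ps; apply/flattenP.
  by exists (s i) => //; apply/mapP; exists i; rewrite ?mem_enum.
have abs_le (I : finType) (y : I -> F) p i : `|p (y i)| <= \sum_i `|p (y i)|.
  by rewrite (bigD1 i) //= lerDl sumr_ge0.
have [h h0 hP] := poly_vanishing (fabs _ b).
pose y i := pev j t h * b i.
have [s sP] := fabs _ y.
have [c cP] := ler_bound s (fun p => \sum_i `|p (y i)|).
exists c => r.
have fm : divisor (fun p => (c + r)%:Z * poles p).
  by have [s' s'P] := divisor_poles; exists s' => p /s'P->; rewrite mulr0.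
have b0 i : b i != 0.
  apply/eqP => bi; have := b_indep (c := fun l => (l == i)%:R).
  case/(_ _)/wrap => [|/(_ i)/eqP]; last by rewrite eqxx oner_eq0.
  by rewrite big1 // => l _; case: eqP => [->|_]; rewrite ?bi ?mulr0 // /pev rmorph0 horner0 mul0r.
have y0 i : y i != 0 by rewrite mulf_neq0 ?t_tr.
rewrite lez_nat -[n]card_ord -[r]card_ord -card_prod card_ord.
apply: (ell_free (b := fun u : 'I_n * 'I_r => (t ^+ u.2 * y u.1 : F))) => //; last first.
  move=> [i e] p; pose w : F := t ^+ e * y i.
  change (vge p (- ((c + r)%:Z * poles p)) w); rewrite /w.
  have te0 : t ^+ e != 0 by apply: expf_neq0 t_neq0.
  rewrite vgeE; last by rewrite mulf_neq0.
  rewrite (placevM p te0 (y0 i)).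
  rewrite placevX -mulr_natr natz /poles.
  have [pt|pt] := lerP 0 (p t).
    rewrite max_l ?oppr_le0 // mulr0 oppr0 addr_ge0 ?mulr_ge0 //.
    rewrite placevM ?t_tr //; have := hP p pt; have := abs_le _ b p i; lia.
  rewrite max_r; last by rewrite oppr_ge0 ltW.
  have := ltn_ord e; have yc : - c%:Z <= p (y i).
    have [ps|ps] := boolP (p \in s).
      by have := cP p ps; have := abs_le _ y p i; lia.
    by have := abs_le _ y p i; rewrite sP //; lia.
  nia.
move=> d d0.
pose c' i : {poly k} := \poly_(e < r) (if insub e is Some e' then d (i, e') else 0).
have c'E i : pev j t (c' i) = \sum_(e < r) j (d (i, e)) * t ^+ e.
  rewrite (pev_coef j t (size_poly _ _)); apply: eq_bigr => e _.
  by rewrite coef_poly ltn_ord valK.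
have c'0 : \sum_i pev j t (c' i) * b i = 0.
  apply: (mulfI (t_tr h0)); rewrite mulr0 -[RHS]d0 /kcomb mulr_sumr.
  transitivity (\sum_i \sum_(e < r) j (d (i, e)) *: (t ^+ e * y i : F^o)).
    apply: eq_bigr => i _; rewrite c'E mulrCA -/(y i) mulr_suml.
    by apply: eq_bigr => e _; rewrite -mulrA.
  by rewrite pair_bigA; apply: eq_bigr => -[].
move=> [i e]; have := congr1 (fun g : {poly k} => g`_e) (b_indep c'0 i).
by rewrite coef_poly ltn_ord valK coef0.
Qed.

(** Any [D] is bounded by a multiple of [poles] plus the divisor of a polynomial [f(t)]
    which vanishes enough at the finite places of the support.  Multiplication by
    [f(t)] does not change [ell], and the three degrees involved are controlled by
    [div_degree_poles], [zeros_div_degree] and [ell_poles]. *)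
Lemma riemann_bound_basis : exists C : int, forall D, divisor D ->
  div_degree D - (ell D)%:Z <= C.
Proof.
have [c cP] := ell_poles; exists (n * c)%:Z => D fD.
have [s0 sP0] := fD.
pose A p : int := `|D p|.
have fA : divisor A by exists s0 => p /sP0; rewrite /A => ->.
have [f f0 fP] := poly_vanishing fA.
pose d := (size f).-1; pose z := pev j t f.
have z0 : z != 0 by apply: t_tr.
have [M MP] := ler_bound s0 A.
pose m := (d + M)%N.
pose E p := p z + d%:Z * poles p.
have fE : divisor E.
  by apply: (divisor_map2 (f := fun x y => x + d%:Z * y)) (divisor_principal z) divisor_poles; rewrite mulr0.
have fT (l : int) : divisor (fun p => l * poles p).
  by have [s' s'P] := divisor_poles; exists s' => p /s'P->; rewrite mulr0.
pose D' p := (c + m - d)%:Z * poles p + 1 * E p.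
have fD' : divisor D'.
  by apply: (divisor_map2 (f := fun x y => (c + m - d)%:Z * x + 1 * y)) divisor_poles fE; rewrite !mulr0.
(* at the poles of t, E vanishes and the remaining coefficient c + M absorbs D *)
have DD' p : D p <= D' p.
  rewrite /D' /E /poles; have [pt|pt] := lerP 0 (p t).
    rewrite max_l ?oppr_le0 //; have := fP p pt; rewrite -/z /A; lia.
  rewrite max_r ?oppr_ge0 ?(ltW pt) // /z (pev_pole pt f0) -/d.
  have DM : D p <= M%:Z.
    have [ps|ps] := boolP (p \in s0); last by rewrite sP0.
    by have := MP p ps; rewrite /A; lia.
  have -> : (c + m - d)%:Z = c%:Z + M%:Z by rewrite /m; lia.
  nia.
have [_ [_ _ le]] := ell_step fD fD' DD'; apply: (le_trans le).
have -> : ell D' = ell (fun p => (c + m)%:Z * poles p).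
  rewrite -(ell_mul (fT (c + m)%:Z) (invr_neq0 z0)); congr ell.
  apply/funext => p; rewrite /D' /E placevV opprK.
  have -> : (c + m - d)%:Z = (c + m)%:Z - d%:Z by rewrite /m; lia.
  ring.
rewrite (div_degree_lin _ _ divisor_poles fE) mul1r.
have := cP m; have := zeros_div_degree f0; have := div_degree_poles.
rewrite -/z -/d -[fun p => _]/E !PoszM.
have -> : (c + m - d)%:Z = c%:Z + M%:Z by rewrite /m; lia.
have -> : m%:Z = d%:Z + M%:Z by rewrite /m.
nia.
Qed.

End Bound.

Lemma riemann_bound : exists C : int, forall D, divisor D ->
  div_degree D - (ell D)%:Z <= C.
Proof.
have [t [n [b [t_tr b_span b_indep]]]] := function_field_basis ffF.
exact: riemann_bound_basis t_tr b_span b_indep.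
Qed.

(** A bounded set of integers has a maximum; as the defect does not decrease with the
    divisor, it is also attained at an effective one. *)
Lemma riemann_extremal : exists D0, [/\ divisor D0, forall p, 0 <= D0 p
  & forall D, divisor D ->
    div_degree D - (ell D)%:Z <= div_degree D0 - (ell D0)%:Z].
Proof.
have [C CP] := riemann_bound.
pose P (N : nat) := `[< exists2 D, divisor D & C - (div_degree D - (ell D)%:Z) = N%:Z >].
have inP D : divisor D -> P `|(C - (div_degree D - (ell D)%:Z))%R|%N.
  move=> fD; apply/asboolP; exists D => //.
  by rewrite gez0_abs // subr_ge0 CP.
have [N /asboolP[D1 fD1 D1N] Nmin] := ex_minnP (ex_intro P _ (inP _ divisor0)).
pose D0 p := Order.max (D1 p) 0.
have fD0 : divisor D0 by apply: (divisor_map2 (f := Order.max)) fD1 divisor0.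
have D10 p : D1 p <= D0 p by rewrite le_max lexx.
have [_ [_ _ le]] := ell_step fD1 fD0 D10.
exists D0; split=> // [p|D fD]; first by rewrite le_max lexx orbT.
apply: le_trans le.
have := Nmin _ (inP D fD); have := CP D fD; lia.
Qed.

(** * The genus *)

Definition bounded_adele D : set (place j -> F^o) :=
  filtration (@adele _ _ j) setT (fun p (u : place j -> F^o) => u p) D.

(** The sum of [bounded_adele D] and of the diagonal, for divisors [D]. *)
Definition bounded_mod_principal D : set (place j -> F^o) :=
  [set u | exists a : F, forall p, vge p (- D p) (u p - a)].

Lemma adele_subspace : ksubspace j (@adele _ _ j).
Proof.
split.
- rewrite /adele /= (_ : [set p | _] = set0); first exact: finite_set0.
  by apply/seteqP; split=> // p /=; rewrite local_ringE; apply; apply: vge0.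
- move=> u v fu fv; apply: sub_finite_set (_ : finite_set (_ `|` _)).
    2: by rewrite finite_setU; split; [exact: fu | exact: fv].
  move=> p /=; rewrite local_ringE => uv; apply: contrapT => /not_orP[/contrapT up /contrapT vp].
  by apply: uv; apply: vgeD.
- move=> c u; apply: sub_finite_set => p /=; apply: contra_not => up.
  rewrite local_ringE in up *.
  by have [_ _ vZ] := vge_subspace p 0; apply: vZ.
Qed.

Lemma divisor_finite D : divisor D -> finite_set [set p | D p != 0].
Proof.
move=> [s sP]; apply: (@sub_finite_set _ _ [set` s]); last exact: finite_seq.
by move=> p /=; apply: contraNT => /sP->.
Qed.

(** Such a [u] can fail to be integral only in the support of [D]. *)
Lemma adele_vge D (u : place j -> F^o) : divisor D ->
  (forall p, vge p (- D p) (u p)) -> (@adele _ _ j) u.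
Proof.
move=> /divisor_finite fD uD; apply: sub_finite_set fD => p /=.
rewrite local_ringE => np; apply/eqP => Dp; apply: np.
by have := uD p; rewrite Dp oppr0.
Qed.

Lemma bounded_adele_subspace D : ksubspace j (bounded_adele D).
Proof. by apply: filtration_subspace; [exact: adele_subspace | move=> p c u v]. Qed.

Lemma bounded_mod_principal_subspace D : ksubspace j (bounded_mod_principal D).
Proof.
split=> [|u v [a ua] [c vc]|c u [a ua]].
- by exists 0 => p; rewrite subr0; apply: vge0.
- by exists (a + c) => p; rewrite opprD addrACA; apply: vgeD.
- exists (j c * a) => p; rewrite (_ : _ - _ = j c *: (u p - a : F^o)); last by rewrite scalerBr.
  by have [_ _ vZ] := vge_subspace p (- D p); apply: vZ.
Qed.

Lemma bounded_adele_kdim D D' : divisor D -> divisor D' -> (forall p, D p <= D' p) ->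
  exists2 m : nat, has_kdim j (bounded_adele D') (bounded_adele D) m & m%:Z = div_degree D' - div_degree D.
Proof.
move=> fD fD' DD'; have [s [us sD sD']] := common_support fD fD'.
exists (\sum_(p <- s) `|(D' p - D p)%R| * degree p)%N; last exact: div_degree_diff.
apply: filtration_kdim => //.
- exact: adele_subspace.
- by move=> p _; apply: residue_kdim.
- move=> p D1 a m _ aD1; pose u q : F^o := if q == p then a else 0.
  exists u; last by rewrite /u eqxx subrr; apply: vge0.
  split; last by move=> q _; rewrite /u; case: eqP => [->//|_]; apply: vge0.
  apply: (@sub_finite_set _ _ [set p]); last exact: finite_set1.
  move=> q /=; rewrite /u; case: eqP => //= _; rewrite local_ringE; apply: contra_notP => _.
  exact: vge0.
- by move=> p ps; rewrite sD // sD'.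
Qed.

(** The quotient of [bounded_adele D'] by [bounded_adele D] has dimension the difference
    of the degrees; dividing out the diagonal removes from it the part
    [Lspace D' / Lspace D]. *)
Lemma bounded_mod_principal_kdim D D' : divisor D -> divisor D' -> (forall p, D p <= D' p) ->
  exists2 m : nat, has_kdim j (bounded_mod_principal D') (bounded_mod_principal D) m
    & m%:Z = (div_degree D' - (ell D')%:Z) - (div_degree D - (ell D)%:Z).
Proof.
move=> fD fD' DD'; have [m0 dm0 m0E] := bounded_adele_kdim fD fD' DD'.
pose M : set (place j -> F^o) := bounded_adele D' `&` bounded_mod_principal D.
have sM : ksubspace j M.
  have [A0 AA AZ] := bounded_adele_subspace D'; have [B0 BA BZ] := bounded_mod_principal_subspace D.
  split; first by split.
    by move=> u v [? ?] [? ?]; split; [exact: AA | exact: BA].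
  by move=> c u [? ?]; split; [exact: AZ | exact: BZ].
have DM : bounded_adele D `<=` M.
  move=> u [au uD]; split; first by split=> // p _; apply: vge_le (uD p I); rewrite lerN2.
  by exists 0 => p; rewrite subr0; apply: uD.
have [m1 [m2 [d1 d2 m12]]] := has_kdim_split (bounded_adele_subspace D') sM (bounded_adele_subspace D) DM (@subIsetl _ _ _) dm0.
have [m3 [d3 m3E _]] := ell_step fD fD' DD'.
have m23 : m3 = m2.
  apply: (has_kdim_uniq (bounded_adele_subspace D) _ d2).
  move: d3; move/(has_kdim_iso (phi := fun (a : F^o) => (fun=> a) : place j -> F^o)); apply.
  - by move=> c u v.
  - exact: Lspace_subspace.
  - exact: bounded_adele_subspace.
  - move=> a aD'; split.
      by split=> [|p _]; [apply: (adele_vge fD' aD') | exact: aD'].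
    by exists a => p; rewrite subrr; apply: vge0.
  - by move=> a aD; split=> [|p _]; [apply: (adele_vge fD aD) | exact: aD].
  - by move=> a [_ aD] _ p; apply: aD.
  - exact: Lspace_subspace.
  - move=> u [[au uD'] [a ua]]; exists a.
      move=> p; have -> : a = u p - (u p - a) by rewrite opprB addrC subrK.
      by apply: vgeB; [exact: uD' | apply: vge_le (ua p); rewrite lerN2].
    have ua' : forall p, vge p (- D p) ((u - (fun=> a)) p) by exact: ua.
    by split=> [|p _]; [apply: (adele_vge fD ua') | exact: ua'].
exists m1; last by rewrite m3E m23 PoszD; move: m0E; rewrite m12 PoszD; lia.
move: d1; move/(has_kdim_iso (phi := id)); apply.
- by [].
- exact: sM.
- exact: bounded_mod_principal_subspace.
- by move=> u [_ uD]; exists 0 => p; rewrite subr0; apply: uD.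
- by move=> u [].
- by move=> u.
- exact: bounded_adele_subspace.
- move=> u [a ua]; have ua' : forall p, vge p (- D' p) ((u - (fun=> a)) p) by exact: ua.
  exists (u - (fun=> a)).
    by split=> [|p _]; [apply: (adele_vge fD' ua') | exact: ua'].
  exists a => p; change (vge p (- D p) (u p - (u p - a) - a)).
  by rewrite subKr subrr; apply: vge0.
Qed.

(** Above an extremal [D0] the dimensions in [bounded_mod_principal_kdim] vanish, so
    all adeles are in [bounded_mod_principal D0], and the first cohomology of the
    structure sheaf is read off between the divisors 0 and [D0]. *)
Theorem genus_extremal : exists2 D0, divisor D0 &
  (forall D, divisor D -> div_degree D - (ell D)%:Z <= div_degree D0 - (ell D0)%:Z)
  /\ genus j = 1 + (div_degree D0 - (ell D0)%:Z).
Proof.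
have [D0 [fD0 D0ge max0]] := riemann_extremal; exists D0 => //; split=> //.
have ippE : @integral_plus_principal _ _ j = bounded_mod_principal (fun=> 0).
  apply/seteqP; split=> u [a ua]; exists a => p.
    by have := ua p; rewrite local_ringE oppr0.
  by have := ua p; rewrite local_ringE oppr0.
have adeleE : (@adele _ _ j) = bounded_mod_principal D0.
  apply/seteqP; split=> [u au|u [a ua]]; last first.
    have ua' : forall p, vge p (- D0 p) ((u - (fun=> a)) p) by exact: ua.
    have [_ AA _] := adele_subspace.
    rewrite -[u](subrK (fun=> a)); apply: AA; first exact: adele_vge fD0 ua'.
    apply: (adele_vge (D := fun p => - p a)); last first.
      by move=> p; rewrite opprK; apply: vge_self.
    by have [s sP] := divisor_principal a; exists s => p /sP->; rewrite oppr0.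
  pose D' p := Order.max (D0 p) (- p (u p)).
  have fD' : divisor D'.
    have [s sP] := fD0; exists (s ++ fset_set [set p | ~ local_ring p (u p)]) => p.
    rewrite mem_cat negb_or => /andP[/sP Dp].
    rewrite (in_fset_set au) notin_setE /= => /contrapT; rewrite local_ringE /D' Dp /vge /=.
    by case: eqP => [->|_ /=]; [rewrite placev0 oppr0 maxxx | move=> up; rewrite max_l // oppr_le0].
  have DD' p : D0 p <= D' p by rewrite le_max lexx.
  have [m dm mE] := bounded_mod_principal_kdim fD0 fD' DD'.
  have m0 : m = 0%N by have := max0 D' fD'; lia.
  rewrite m0 in dm; apply: (has_kdim0P (bounded_mod_principal_subspace D0) dm).
  exists 0 => p; rewrite subr0 /vge /= /D'; apply/orP; right; lia.
have [m dm mE] := bounded_mod_principal_kdim divisor0 fD0 D0ge.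
have h1E : h1 j = m.
  by rewrite /h1 adeleE ippE; apply: kdimE dm; apply: bounded_mod_principal_subspace.
have h0E : h0 j = ell (fun=> 0).
  rewrite /h0 /ell; congr kdim; apply/seteqP; split=> a aP p; have := aP p.
    by rewrite local_ringE oppr0.
  by rewrite local_ringE oppr0.
have d0 : div_degree (fun=> 0) = 0 by rewrite (@div_degreeE _ [::]) // big_nil.
by rewrite /genus h1E h0E mE d0; lia.
Qed.

Theorem riemann_inequality D : divisor D ->
  div_degree D + 1 - genus j <= (ell D)%:Z.
Proof. by have [D0 _ [max0 ->]] := genus_extremal => /max0; lia. Qed.

(** Since [ell (- n div z)] does not depend on [n], Riemann's inequality bounds the
    degrees of all the multiples, positive and negative, of the divisor of [z]. *)
Theorem div_degree_principal z : z != 0 -> div_degree (fun p => p z) = 0.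
Proof.
move=> z0; have bound (n : int) : div_degree (fun p => p z) * n
    <= (ell (fun=> 0))%:Z + genus j - 1.
  have fn : divisor (fun p => n * p z + 0 * p z).
    apply: (divisor_map2 (f := fun x y => n * x + 0 * y)) (divisor_principal z) (divisor_principal z).
    by rewrite !mulr0.
  have := riemann_inequality fn.
  rewrite (div_degree_lin _ _ (divisor_principal z) (divisor_principal z)).
  have -> : ell (fun p => n * p z + 0 * p z) = ell (fun=> 0).
    rewrite -(ell_mul divisor0 (expfz_neq0 (- n) z0)); congr ell.
    by apply/funext => p; rewrite placevXz; lia.
  lia.
set d := div_degree _ in bound *.
have := bound 0; set B := (_ + _ - 1) in bound *; rewrite mulr0 => B0.
(* the multiple by d (B + 1) has degree d^2 (B + 1), which exceeds B *)
have := bound (d * (B + 1)).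
have [//|d0] := eqVneq d 0.
have : 1 <= d * d by nia.
nia.
Qed.

End Riemann.

(** * Places of a finite extension above a given place *)

Section Above.
Variables (k K : fieldType) (iota : {rmorphism k -> K}).

Section Degrees.
Variable L : fieldExtType K.
Local Notation j := (ext_const iota L).
Hypotheses (ffK : function_field iota) (ffL : function_field j).

Lemma alg_neq0 (a : K) : a != 0 -> a%:A != 0 :> L.
Proof. by move=> a0; rewrite scaler_eq0 oner_eq0 orbF. Qed.

Lemma vge_under (q : place j) (p : place iota) (m : int) (a : K) : under q = p ->
  vge p m a -> vge q (m * (ram q)%:Z) (a%:A : L).
Proof.
move=> <-; have [->|a0] := eqVneq a 0; first by rewrite scale0r => _; apply: vge0.
rewrite !vgeE ?alg_neq0 // (underE q) => ma.
by rewrite ler_wpM2r.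
Qed.

Lemma vge_scale (q : place j) (p : place iota) (m n : int) (a : K) (u : L) :
  under q = p -> vge p m a -> vge q n u -> vge q (m * (ram q)%:Z + n) (a *: u).
Proof.
by move=> qp am un; rewrite -mulr_algl; apply: vgeM => //; apply: vge_under qp am.
Qed.

Variables (p : place iota) (s : seq (place j)).
Hypotheses (us : uniq s) (sp : forall q, q \in s -> under q = p).

Let D1 (q : place j) : int := if q \in s then - (ram q)%:Z else 0.
Let B := semilocal s (fun=> 0).
Let B1 := semilocal s D1.

(** The classes of the [b i] modulo [B1], the ideal of [B] generated by a uniformizer
    of [p], are independent over the residue field of [p]. *)
Definition residually_free m (b : 'I_m -> L) := forall a : 'I_m -> K,
  (forall i, vge p 0 (a i)) -> B1 (\sum_i a i *: b i) -> forall i, vge p 1 (a i).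

Let B1_scale a u : vge p 0 a -> B1 u -> B1 (a *: u).
Proof.
move=> ap [_ Bu]; split=> // q qs.
by have := vge_scale (sp qs) ap (Bu q qs); rewrite mul0r add0r.
Qed.

Let B_scale1 a u : vge p 1 a -> B u -> B1 (a *: u).
Proof.
move=> ap [_ Bu]; split=> // q qs; have := vge_scale (sp qs) ap (Bu q qs).
by rewrite /D1 qs mul1r opprK oppr0 addr0.
Qed.

(** A relation over [K], scaled by a power of a uniformizer so that its coefficients
    are integral at [p] but not all in the maximal ideal, would contradict
    independence over the residue field. *)
Lemma residually_free_le m (b : 'I_m -> L) : residually_free b ->
  (m <= \dim {:L})%N.
Proof.
move=> bfree; suff fb : free [tuple b i | i < m].
  have := dimvS (subvf <<[tuple b i | i < m]>>%VS).
  by rewrite (eqP (fb : _ == _)) size_tuple.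
apply/freeP => a a0; apply: contrapT => na.
have [i0 ai0] : exists i, a i != 0.
  by apply: contrapT => no; apply: na => i; apply: contrapT => /eqP ai; apply: no; exists i.
case: (@Order.TotalTheory.arg_minP _ int 'I_m i0 (fun i => a i != 0) (fun i => p (a i)) ai0) => i ai imin.
have [z z0 pz] := placev_onto p (- p (a i)).
have : vge p 1 (z * a i).
  apply: (bfree (fun l => z * a l)) => [l|].
    have [->|al] := eqVneq (a l) 0; first by rewrite mulr0; apply: vge0.
    by rewrite vgeE ?mulf_neq0 // placevM // pz; have := imin l al; lia.
  rewrite (_ : \sum_l _ = 0); first by case: (semilocal_subspace s D1).
  rewrite -[RHS](scaler0 _ z) -[in RHS]a0 scaler_sumr; apply: eq_bigr => l _.
  by rewrite scalerA (nth_map i) ?size_enum_ord // nth_ord_enum.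
by rewrite vgeE ?mulf_neq0 // placevM // pz; lia.
Qed.

(** The left hand side is the dimension of [B / B1] over [k].  A maximal residually
    free family is a basis over the residue field of [p]; it has at most
    [\dim {:L}] members, each of which accounts for [degree p] dimensions. *)
Theorem sum_ram_degree_le :
  (\sum_(q <- s) ram q * degree q <= \dim {:L} * degree p)%N.
Proof.
have kd : has_kdim j B B1 (\sum_(q <- s) ram q * degree q)%N.
  have -> : (\sum_(q <- s) ram q * degree q =
      \sum_(q <- s) `|(0 - D1 q)%R| * degree q)%N.
    rewrite big_seq [RHS]big_seq; apply: eq_bigr => q qs.
    by rewrite /D1 qs sub0r opprK.
  apply: (semilocal_kdim ffL us) => q; rewrite /D1; last by move/negbTE->.
  by case: ifP => // _; rewrite oppr_le0.
pose P m := `[< exists b : 'I_m -> L, (forall i, B (b i)) /\ residually_free b >].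
have exP : exists m, P m.
  by exists 0%N; apply/asboolP; exists (fun=> 0); split; [case | move=> a _ _ []].
have boundP m : P m -> (m <= \dim {:L})%N.
  by move=> /asboolP[b [_ /residually_free_le]].
have [m Pm mmax] := ex_maxnP exP boundP.
have /asboolP[b [Bb bfree]] := Pm.
have [e [e0 efree espan]] := has_kdim_basis (vge_subspace p 1) (residue_kdim ffK p).
apply: leq_trans (_ : m * degree p <= _)%N; last by rewrite leq_mul2r boundP ?orbT.
have sB := @semilocal_subspace _ _ j s (fun=> 0).
have sB1 := @semilocal_subspace _ _ j s D1.
have [B10 B1D _] := sB1.
have -> : (m * degree p)%N = #|{: 'I_m * 'I_(degree p)}|.
  by rewrite card_prod !card_ord.
pose eb (u : 'I_m * 'I_(degree p)) : L^o := (e u.2 : K) *: b u.1.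
apply: (kspan_geq_kdim (e := eb) sB1 kd).
move=> u Bu; have [a0 [a [a0p [ap [B1a nmax]]]]] : exists a0 (a : 'I_m -> K),
    vge p 0 a0 /\ (forall i, vge p 0 (a i)) /\ B1 (a0 *: u + \sum_i a i *: b i) /\
    ~ (vge p 1 a0 /\ forall i, vge p 1 (a i)).
  apply: contrapT => no; suff /mmax : P m.+1 by rewrite ltnn.
  apply/asboolP; exists (fun i => if unlift ord0 i is Some l then b l else u).
  split=> [i|a ap]; first by case: unlift.
  rewrite big_ord_recl unlift_none.
  under eq_bigr => i _ do rewrite liftK.
  move=> B1a; apply: contrapT => nmax; apply: no.
  exists (a ord0), (fun i => a (lift ord0 i)); split=> //; split=> //; split=> //.
  move=> [m0 m1]; apply: nmax => i.
  by case: (unliftP ord0 i) => [l|] ->.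
have a01 : ~ vge p 1 a0.
  move=> a01; apply: nmax; split=> //; apply: bfree => //.
  have -> : \sum_i a i *: b i = (a0 *: u + \sum_i a i *: b i) - a0 *: u.
    by rewrite addrC addKr.
  by apply: (ksubB sB1) => //; apply: B_scale1.
have a00 : a0 != 0 by apply/eqP => a00; apply: a01; rewrite a00; apply: vge0.
have pa0 : p a0 = 0.
  by move: a01 a0p; rewrite !vgeE // => /negP; rewrite -ltNge; lia.
have a0V : vge p 0 a0^-1 by rewrite vgeE ?invr_eq0 // placevV pa0.
pose al i := - (a0^-1 * a i).
have alp i : vge p 0 (al i).
  by apply: vgeN; rewrite -[0]addr0; apply: vgeM.
have Bal : B1 (u - \sum_i al i *: b i).
  have := B1_scale a0V B1a; rewrite scalerDr scalerA mulVf // scale1r scaler_sumr.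
  congr (B1 (_ + _)); rewrite -sumrN; apply: eq_bigr => i _.
  by rewrite scalerA /al scaleNr opprK.
have /choice[c cP] i := espan (al i) (alp i).
exists (fun v => c v.1 v.2).
have -> : kcomb j (fun v => c v.1 v.2) (fun v : 'I_m * 'I_(degree p) => e v.2 *: b v.1 : L^o)
    = \sum_i kcomb iota (c i) e *: b i.
  rewrite /kcomb.
  transitivity (\sum_i \sum_l j (c i l) *: (e l *: b i : L^o)).
    by rewrite pair_bigA; apply: eq_bigr => -[].
  apply: eq_bigr => i _; rewrite scaler_suml; apply: eq_bigr => l _.
  rewrite -[j (c i l) *: _]/(in_alg L (iota (c i l)) * (e l *: b i)) /=.
  by rewrite mulr_algl scalerA.
rewrite -[u](subrK (\sum_i al i *: b i)) -addrA -sumrB; apply: B1D => //.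
apply: (ksub_sum sB1) => i _.
rewrite (_ : _ - _ = (al i - kcomb iota (c i) e : K) *: b i); last by rewrite scalerBl.
by apply: B_scale1 => //; apply: cP.
Qed.

End Degrees.

Section Galois.
Variable L : splittingFieldType K.
Local Notation j := (ext_const iota L).
Hypothesis galLK : galois 1%AS {:L}%AS.

Lemma conj_placeP (q : place j) (g : gal_of {:L}) :
  normalized_valuation j (fun a => q (g a)).
Proof.
have gA (c : K) : g c%:A = c%:A by rewrite linearZ /= rmorph1.
split=> [|c c0|a b a0 b0|a b a0 b0 ab0|].
- by rewrite rmorph0 placev0.
- by rewrite [j c]/= gA; apply: (placev_const q c).
- by rewrite rmorphM placevM ?fmorph_eq0.
- by rewrite rmorphD; apply: placevD; rewrite -?rmorphD fmorph_eq0.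
- have [u _ qu] := uniformizer q; exists ((g^-1)%g u).
  by rewrite -galM ?memvf // mulVg gal_id.
Qed.

Definition conj_place q g := Place (conj_placeP q g).

(** If [q'] were not conjugate to [q], approximation would give a [y] which is a zero
    of all the conjugates of [q'] but a unit at those of [q]; its norm, an element
    of [K], would be a zero of [q'] but a unit at [q]. *)
Lemma places_conjugate (q q' : place j) : under q = under q' ->
  exists g, q' = conj_place q g.
Proof.
move=> qq'; apply: contrapT => no.
pose s1 := [seq conj_place q g | g : gal_of {:L}].
pose s2 := [seq conj_place q' g | g : gal_of {:L}].
have s2s1 g : conj_place q' g \notin s1.
  apply/mapP => -[h _ gh]; apply: no; exists (g^-1 * h)%g.
  apply: place_inj => a /=; rewrite galM ?memvf //.
  have /= := congr1 (fun r : place j => r ((g^-1)%g a)) gh.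
  by rewrite -galM ?memvf // mulVg gal_id.
have [y yP] := weak_approximation (fun r => if r \in s1 then 1 else 0)
  (fun=> 1) (undup_uniq (s1 ++ s2)).
have y1 g : vge (conj_place q g) 1 (y - 1).
  have qs : conj_place q g \in s1 by apply/mapP; exists g; rewrite ?mem_enum.
  by have := yP (conj_place q g); rewrite mem_undup mem_cat qs; apply.
have y2 g : vge (conj_place q' g) 1 y.
  have qs : conj_place q' g \in s2 by apply/mapP; exists g; rewrite ?mem_enum.
  have := yP (conj_place q' g); rewrite mem_undup mem_cat qs orbT (negbTE (s2s1 g)).
  by rewrite subr0; apply.
have yunit (g : gal_of {:L}) : y != 0 /\ q (g y) = 0.
  have [] := @placevD_lt _ _ j (conj_place q g) 1 (y - 1).
  - exact: oner_neq0.
  - by move: (y1 g); rewrite /vge /= rmorph1 placev1 gtz0_ge1.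
  by rewrite addrC subrK /= rmorph1 placev1.
have [y0 _] := yunit 1%g.
have /vlineP[c Nc] : galNorm 1 {:L} y \in 1%VS.
  by have := galNorm_fixedField 1%AS (memvf y); rewrite (galois_fixedField galLK).
have valN (r : place j) : r (galNorm 1 {:L} y) = \sum_(g in 'Gal({:L} / 1)%g) r (g y).
  have main (l : seq (gal_of {:L})) (Q : pred (gal_of {:L})) :
      \prod_(g <- l | Q g) g y != 0 /\ r (\prod_(g <- l | Q g) g y) = \sum_(g <- l | Q g) r (g y).
    elim: l => [|g l [IH0 IH]]; first by rewrite !big_nil oner_neq0 placev1.
    rewrite !big_cons; case: ifP => // _.
    by rewrite mulf_neq0 ?fmorph_eq0 // placevM ?fmorph_eq0 // IH.
  by have [] := main (index_enum _) (mem 'Gal({:L} / 1)%g).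
have qc : under q c = 0.
  have := valN q; rewrite big1 => [|g _]; last by case: (yunit g).
  by rewrite Nc underE; have := ram_gt0 q; nia.
have := valN q'; rewrite Nc underE -qq' qc mul0r (bigD1 1%g) ?group1 //= => q'0.
have ge1 (g : gal_of {:L}) : 1 <= q' (g y) by have := y2 g; rewrite vgeE.
have : 0 <= \sum_(g in 'Gal({:L} / 1)%g | g != 1%g) q' (g y).
  by apply: sumr_ge0 => g _; apply: le_trans (ge1 g).
by move=> s0; have := lerD (ge1 1%g) s0; rewrite -q'0.
Qed.

(** The conjugation of [q] and [q'] is trivial on [K]. *)
Lemma ram_under (q q' : place j) : under q = under q' -> ram q = ram q'.
Proof.
move=> qq'; have [g gE] := places_conjugate qq'.
have [c _ qc] := uniformizer (under q).
have qcE : q' c%:A = q c%:A by rewrite gE /= linearZ /= rmorph1.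
have qE := underE q c; rewrite qc mul1r in qE.
have q'E := underE q' c; rewrite -qq' qc mul1r in q'E.
by apply/eqP; rewrite -eqz_nat -qE -q'E qcE.
Qed.

Lemma ram_atE (q : place j) : ram_at L (under q) = ram q.
Proof.
rewrite /ram_at; case: xgetP => [m -> [q' /= q'q <-]|no]; first exact: ram_under.
by exfalso; apply: (no (ram q)); exists q.
Qed.

End Galois.
End Above.

(** * Sums of integral parts along an arithmetic progression *)

Section FloorSum.

Lemma sum_ord_rat (b : nat) : \sum_(i < b) (i%:R : rat) = b%:R * (b%:R - 1) / 2.
Proof.
elim: b => [|b IHb]; first by rewrite big_ord0 !mul0r.
by rewrite big_ord_recr /= IHb -natr1; field.
Qed.

(** As [a] is prime to [b], the residues of [N + i a] modulo [b] form a permutation of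
    the integers below [b] when [i] runs through a period. *)
Lemma sum_residues (N a : int) (b s : nat) : (0 < b)%N -> coprimez a b%:Z ->
  \sum_(i < s * b) (((N + i%:Z * a) %% b%:Z)%Z%:~R : rat)
  = s%:R * (b%:R * (b%:R - 1) / 2).
Proof.
move=> b0 cab; pose rho (i : nat) := ((N + i%:Z * a) %% b%:Z)%Z.
have bZ : b%:Z != 0 by rewrite eqz_nat -lt0n.
have rho_ge0 i : 0 <= rho i by apply: modz_ge0.
have rho_lt i : (`|rho i| < b)%N.
  by rewrite -ltz_nat gez0_abs // ltz_pmod.
have period : \sum_(i < b) ((rho i)%:~R : rat) = b%:R * (b%:R - 1) / 2.
  pose h (i : 'I_b) := Ordinal (rho_lt i).
  have hI : injective h.
    move=> i l /(congr1 val) /= /(congr1 Posz); rewrite !gez0_abs //.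
    move=> /eqP; rewrite /rho eqz_modDl eqz_mod_dvd -mulrBl Gauss_dvdzl; last first.
      by rewrite coprimez_sym.
    move=> /dvdzP[m mE]; apply: val_inj => /=.
    have := ltn_ord i; have := ltn_ord l.
    by have [m0|m0|m0] := ltgtP m 0; nia.
  rewrite -sum_ord_rat [RHS](reindex_inj hI); apply: eq_bigr => i _ /=.
  by transitivity (((`|rho i|%N)%:Z)%:~R : rat); first by rewrite gez0_abs.
elim: s => [|s IHs]; first by rewrite mul0n big_ord0 mul0r.
rewrite mulSn big_split_ord /= period -[s.+1%:R]natr1 mulrDl mul1r addrC -IHs; congr (_ + _).
apply: eq_bigr => i _; congr (_%:~R); apply/eqP.
rewrite PoszD mulrDl addrA [N + _]addrC -addrA eqz_mod_dvd.
have -> : N + (b%:Z * a + i%:Z * a) - (i%:Z * a + N) = b%:Z * a by ring.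
exact: dvdz_mulr.
Qed.

(** With [y = a / b] in lowest terms and [n = N / b], taking the integral part of
    [(N + i a) / b] removes from it the residue of [N + i a] divided by [b]; as [b]
    divides [r], these residues run through entire periods. *)
Lemma sum_floor (n y : rat) (r : nat) : (0 < r)%N -> (r%:R * y \is a Num.int) ->
  ((denq y)%:~R * n \is a Num.int) ->
  \sum_(i < r) ((Num.floor (n + i%:R * y))%:~R : rat)
  = r%:R * n + r%:R * (r%:R - 1) / 2 * y
    - r%:R / 2 * (((denq y)%:~R - 1) / (denq y)%:~R).
Proof.
move=> r0 /intrP[v vE] /intrP[N NE].
have b0Z := denq_gt0 y.
pose b := `|denq y|%N; have bE : b%:Z = denq y by rewrite /b gez0_abs // ltW.
have b0 : (0 < b)%N by rewrite -ltz_nat bE.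
have bR : (denq y)%:~R = b%:R :> rat by rewrite -bE -pmulrn.
have bR0 : b%:R != 0 :> rat by rewrite pnatr_eq0 -lt0n.
have yE : y = (numq y)%:~R / b%:R by rewrite -bR divq_num_den.
have cab : coprimez (numq y) b%:Z by rewrite coprimezE coprime_num_den.
have dvd_br : (b %| r)%N.
  have : (b%:Z %| r%:Z * numq y)%Z.
    apply/dvdzP; exists v; apply: (@intr_inj rat).
    rewrite !rmorphM /= -!pmulrn -vE {2}yE mulrA mulfVK //.
  by rewrite Gauss_dvdzl // coprimez_sym.
have /dvdnP[s sE] := dvd_br.
have nE : n = N%:~R / b%:R by rewrite -NE bR mulrC mulKf.
have floorE (i : nat) : ((Num.floor (n + i%:R * y))%:~R : rat)
    = n + i%:R * y - ((N + i%:Z * numq y) %% b%:Z)%Z%:~R / b%:R.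
  set M := N + i%:Z * numq y.
  have ME : n + i%:R * y = M%:~R / b%:R.
    by rewrite nE {1}yE /M rmorphD rmorphM /= -pmulrn mulrDl mulrA.
  have MR : M%:~R = (M %/ b%:Z)%Z%:~R * b%:R + (M %% b%:Z)%Z%:~R :> rat.
    by rewrite {1}(divz_eq M b%:Z) rmorphD rmorphM /= -pmulrn.
  have m0 : 0 <= ((M %% b%:Z)%Z%:~R : rat) by rewrite ler0z modz_ge0 // eqz_nat -lt0n.
  have mb : ((M %% b%:Z)%Z%:~R : rat) < b%:R.
    by rewrite -[X in _ < X]/(b%:R) pmulrn ltr_int ltz_pmod.
  rewrite ME (@floor_def _ _ (M %/ b%:Z)%Z).
    by rewrite MR mulrDl mulfK // addrK.
  have bpos : 0 < (b%:R : rat) by rewrite ltr0n.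
  rewrite ler_pdivlMr // ltr_pdivrMr // MR intrD mulrDl mul1r.
  by rewrite lerDl m0 ltrD2l.
under eq_bigr => i _ do rewrite floorE.
rewrite sumrB big_split /= -mulr_suml -mulr_suml sum_ord_rat.
rewrite [X in - (X / _)](_ : _ = s%:R * (b%:R * (b%:R - 1) / 2)); last first.
  by rewrite sE; apply: sum_residues.
rewrite sumr_const card_ord -[n *+ r]mulr_natl bR sE natrM; field.
by rewrite bR0.
Qed.

End FloorSum.

(** * Riemann-Roch spaces of the cyclic algebra *)

Section Decomposition.
Variables (k K : fieldType) (iota : {rmorphism k -> K}).
Variables (L : splittingFieldType K) (Phi : gal_of {:L}) (x : K).
Local Notation j := (ext_const iota L).
Local Notation r := #[Phi]%g.

(** The coordinates are freed one at a time. *)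
Lemma kdim_coordinates (A : 'I_r -> set L^o) (n : 'I_r -> nat) :
  (forall i, ksubspace j (A i)) -> (forall i, has_kdim j (A i) [set 0] (n i)) ->
  has_kdim j [set f : cyclic_algebra Phi x | forall i, A i (f i)] [set 0]
    (\sum_i n i).
Proof.
move=> sA dA.
pose P (s : seq 'I_r) : set (cyclic_algebra Phi x) :=
  [set f | forall i, if i \in s then A i (f i) else f i = 0].
have sP s : ksubspace j (P s).
  split=> [i|f g fP gP i|c f fP i]; rewrite ffunE; have [A0 AD AZ] := sA i.
  - by case: ifP.
  - have := fP i; have := gP i; case: ifP => _; first by move=> ? ?; apply: AD.
    by move=> -> ->; rewrite addr0.
  - have := fP i; case: ifP => _; first exact: AZ.
    by move=> ->; rewrite scaler0.
have main s : uniq s -> has_kdim j (P s) [set 0] (\sum_(i <- s) n i).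
  elim: s => [_|i s IHs /= /andP[si us]].
    rewrite big_nil (_ : P [::] = [set 0]).
      exact: has_kdim_refl (zero_subspace j _).
    by apply/seteqP; split=> f; [move=> f0; apply/ffunP => i; rewrite ffunE; exact: f0
      | move=> -> i; rewrite ffunE].
  rewrite big_cons; apply: has_kdim_trans (IHs us).
  - exact: sP.
  - exact: zero_subspace.
  - by move=> f ->; case: (sP s).
  - move=> f fP l; rewrite inE; have := fP l.
    case: eqP => [->|_ //] /=; rewrite (negbTE si) => ->.
    by case: (sA i).
  apply (@has_kdim_iso _ _ _ _ _ (fun f : cyclic_algebra Phi x => f i : L^o) _ _ (A i) [set 0]) => //.
  - by move=> c f g; rewrite !ffunE.
  - exact: zero_subspace.
  - by move=> f /(_ i); rewrite inE eqxx.
  - by move=> f /(_ i); rewrite (negbTE si).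
  - move=> f fi fP l; have := fP l; rewrite inE.
    by case: eqP => [->|//] /= _; rewrite (negbTE si).
  - move=> a Aa; exists ([ffun l => if l == i then a else 0] : cyclic_algebra Phi x).
      move=> l; rewrite inE ffunE; case: eqP => [->//|_] /=.
      by case: ifP => // _; case: (sA l).
    by rewrite ffunE eqxx subrr.
have := main (index_enum 'I_r) (index_enum_uniq _).
congr has_kdim; apply/seteqP; split=> f fP i; have := fP i; by rewrite mem_index_enum.
Qed.

(** The condition on the coefficient of degree [i] reads
    [q (f i) + i * e_q v_p(x) / r + E q >= 0], where [e_q v_p(x)] is the valuation
    of [x] at [q]; the valuation being an integer, the bound is rounded down. *)
Definition coord_div (E : divQ j) (i : nat) (q : place j) : int :=
  Num.floor (E q + i%:R * ((q x%:A)%:~R / r%:R)).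

Lemma RRspaceE (E : divQ j) :
  RRspace Phi x E = [set f | forall i : 'I_r, Lspace (coord_div E i) (f i)].
Proof.
have aff (e c : rat) (y : \bar rat) : 0 < e ->
    (0 <= e%:E * y + c%:E)%E = ((- c / e)%:E <= y)%E.
  move=> e0; case: y => [y| |].
  - rewrite -EFinM -EFinD !lee_fin ler_pdivrMr //.
    by rewrite -lerBlDr sub0r [y * e]mulrC.
  - by rewrite mulry gtr0_sg // mul1e addye // !leey.
  - by rewrite mulrNy gtr0_sg // mul1e addNye leNye_eq.
have pt (f : cyclic_algebra Phi x) (q : place j) (i : 'I_r) :
   ((- E q / (ram q)%:R)%:E <= vale q (f i) * ((ram q)%:R^-1)%:E
      + (i%:R * ((under q x)%:~R / r%:R))%:E)%E <-> vge q (- coord_div E i q) (f i).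
  have e0 : 0 < ((ram q)%:R : rat) by rewrite ltr0n ram_gt0.
  rewrite /vge /vale /=; case: eqP => [_|_] /=.
    by rewrite mulyr gtr0_sg ?invr_gt0 // mul1e addye // leey.
  rewrite -EFinM -EFinD lee_fin.
  rewrite lerNl floor_ge_int (underE q) rmorphN rmorphM /= -pmulrn.
  rewrite ler_pdivrMr // mulrDl mulfVK ?gt_eqF //.
  rewrite -subr_ge0 -[X in _ <-> is_true X]subr_ge0.
  by rewrite (_ : _ - - E q = E q + i%:R * ((under q x)%:~R * (ram q)%:R / r%:R) - - (q (f i))%:~R) //; ring.
apply/seteqP; split=> f fP.
  move=> i q; have e0 : 0 < ((ram q)%:R : rat) by rewrite ltr0n ram_gt0.
  have := fP q; rewrite aff // => /bigmin_geP[_ /(_ i isT)].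
  by move/pt.
move=> q; have e0 : 0 < ((ram q)%:R : rat) by rewrite ltr0n ram_gt0.
rewrite aff //; apply/bigmin_geP; split; first by rewrite leey.
by move=> i _; apply/pt; apply: fP.
Qed.

End Decomposition.

Lemma big_seq_widen (T : eqType) (R : nmodType) (s1 s2 : seq T) (f : T -> R) :
  uniq s1 -> uniq s2 -> {subset s1 <= s2} -> (forall q, q \notin s1 -> f q = 0) ->
  \sum_(q <- s1) f q = \sum_(q <- s2) f q.
Proof.
move=> u1 u2 s12 f0; rewrite [RHS](bigID (mem s1)) /= [X in _ + X]big1 ?addr0 //.
rewrite -[RHS]big_filter; apply: perm_big; apply: uniq_perm; rewrite ?filter_uniq //.
by move=> q; rewrite mem_filter andb_idr // => /s12.
Qed.

Section Assembly.
Variables (k K : fieldType) (iota : {rmorphism k -> K}).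
Variables (L : splittingFieldType K) (Phi : gal_of {:L}) (x : K).
Local Notation j := (ext_const iota L).
Local Notation r := #[Phi]%g.
Hypotheses (ffK : function_field iota) (ffL : function_field j).
Hypothesis galLK : galois 1%AS {:L}%AS.
Hypothesis genPhi : 'Gal({:L} / 1)%g = <[Phi]>%g.
Hypothesis x_neq0 : x != 0.

Let b (p : place iota) : rat := (slope_denom Phi x p)%:Q.

Lemma slope_denomE (q : place j) :
  slope_denom Phi x (under q) = denq ((q x%:A)%:~R / r%:R).
Proof. by rewrite /slope_denom (ram_atE galLK) underE [under q x * _]mulrC. Qed.

Lemma dim_cyclic : \dim {:L} = r.
Proof. by have := galois_dim galLK; rewrite dimv1 divn1 genPhi. Qed.

Definition ramification_term (p : place iota) : rat :=
  (b p - 1) / (b p * (ram_at L p)%:R) * (degree p)%:R.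

Let b_ge1 p : 1 <= b p.
Proof. by rewrite /b ler1z -gtz0_ge1 denq_gt0. Qed.

Lemma ramification_term_ge0 p : 0 <= ramification_term p.
Proof.
have := b_ge1 p => b1; have b0 : 0 <= b p by apply: le_trans b1.
by rewrite mulr_ge0 // divr_ge0 ?subr_ge0 // mulr_ge0.
Qed.

(** The fundamental inequality bounds the total degree of the places above [p] by
    [r * degree p / e_p]. *)
Lemma sum_above_le (s : seq (place j)) (p : place iota) : uniq s ->
  \sum_(q <- s | under q == p) (b p - 1) / b p * (degree q)%:R
    <= r%:R * ramification_term p.
Proof.
move=> us; have [e0|e0] := eqVneq (ram_at L p) 0%N.
  rewrite big1 => [|q /eqP qp]; first by rewrite mulr_ge0 ?ramification_term_ge0.
  by have := ram_gt0 q; rewrite -(ram_atE galLK) qp e0.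
have sp q : q \in [seq q <- s | under q == p] -> under q = p.
  by rewrite mem_filter => /andP[/eqP].
have := sum_ram_degree_le ffK ffL (filter_uniq _ us) sp.
rewrite dim_cyclic big_filter.
under eq_bigr => q /eqP qp do rewrite -(ram_atE galLK) qp.
rewrite -big_distrr /= -(ler_nat rat) !natrM natr_sum => le.
have epos : 0 < ((ram_at L p)%:R : rat) by rewrite ltr0n lt0n.
have b1 := b_ge1 p; have bpos : 0 < b p by apply: lt_le_trans b1.
rewrite -mulr_sumr /ramification_term.
have -> : r%:R * ((b p - 1) / (b p * (ram_at L p)%:R) * (degree p)%:R) =
    (b p - 1) / b p * (r%:R * (degree p)%:R / (ram_at L p)%:R).
  by field; rewrite !gt_eqF.
apply: ler_wpM2l; first by rewrite divr_ge0 ?subr_ge0 // ltW.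
by rewrite ler_pdivlMr // mulrC.
Qed.

(** Only finitely many [p] contribute: the slope is 0, of denominator 1, unless [x] has
    a zero or a pole at [p]. *)
Lemma sum_ramification_le (s : seq (place j)) : uniq s ->
  \sum_(q <- s) (b (under q) - 1) / b (under q) * (degree q)%:R
    <= r%:R * \sum_(p \in [set: place iota]) ramification_term p.
Proof.
move=> us; have [sx sxP] := divisor_principal ffK x.
pose T := undup ([seq under q | q <- s] ++ sx).
have uT : uniq T by apply: undup_uniq.
rewrite (fsbigE T) //; last first.
  move=> p _; rewrite mem_undup mem_cat negb_or => /andP[_ /sxP px].
  rewrite /ramification_term /b /slope_denom px mulr0 mulr0z mul0r.
  by rewrite (_ : denq 0 = 1) // subrr !mul0r.
rewrite (eq_bigl xpredT); last by move=> p; rewrite in_setT.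
apply: (@le_trans _ _ (\sum_(p <- T) \sum_(q <- s | under q == p)
    (b p - 1) / b p * (degree q)%:R)); last first.
  by rewrite mulr_sumr; apply: ler_sum => p _; apply: sum_above_le.
under [leRHS]eq_bigr => p _ do rewrite big_mkcond.
rewrite exchange_big /= big_seq [leRHS]big_seq; apply: ler_sum => q qs.
have uqT : under q \in T by rewrite mem_undup mem_cat map_f.
rewrite -big_mkcond (big_rem _ uqT) /= eqxx.
rewrite big_seq_cond big1 ?addr0 // => p /andP[pT /eqP qp].
by move: pT; rewrite mem_rem_uniq // inE qp eqxx.
Qed.

Variable E : divQ j.
Hypothesis E_denom : forall q : place j,
  (slope_denom Phi x (under q))%:Q * E q \is a Num.int.

Lemma coord_support : exists s : seq (place j), [/\ uniq s,
  {subset finsupp E <= s}, forall q, q \notin s -> E q = 0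
  & forall q, q \notin s -> q x%:A = 0].
Proof.
have [sx sxP] := divisor_principal ffL x%:A.
exists (undup (finsupp E ++ sx)); split=> [|q|q|q].
- exact: undup_uniq.
- by rewrite mem_undup mem_cat => ->.
- by rewrite mem_undup mem_cat negb_or => /andP[/fsfun_dflt].
- by rewrite mem_undup mem_cat negb_or => /andP[_ /sxP].
Qed.

Lemma coord_div_eq0 (i : nat) (q : place j) : E q = 0 -> q x%:A = 0 ->
  coord_div Phi x E i q = 0.
Proof.
by move=> Eq xq; rewrite /coord_div Eq xq mulr0z mul0r mulr0 addr0 floor0.
Qed.

Lemma divisor_coord (i : nat) : divisor (coord_div Phi x E i).
Proof.
have [s [_ _ sE sx]] := coord_support; exists s => q qs.
by rewrite coord_div_eq0 ?sE ?sx.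
Qed.

Lemma RRspace_kdim : has_kdim j (RRspace Phi x E) [set 0]
  (\sum_(i < r) ell (coord_div Phi x E i)).
Proof.
rewrite RRspaceE.
apply: (@kdim_coordinates _ _ _ _ _ _ (fun i : 'I_r => Lspace (coord_div Phi x E i))
  (fun i : 'I_r => ell (coord_div Phi x E i))) => i; first exact: Lspace_subspace.
exact: (ellP ffL (divisor_coord i)).
Qed.

(** For each place the progression is summed by [sum_floor].  The term proportional to
    the valuation of [x] disappears globally, because the degree of a principal
    divisor is 0. *)
Lemma sum_coord_degree :
  \sum_(i < r) (div_degree (coord_div Phi x E i))%:~R
  >= r%:R * divQ_degree E - r%:R ^+ 2 / 2 *
    \sum_(p \in [set: place iota]) ramification_term p :> rat.
Proof.
have [s [us sub sE sx]] := coord_support.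
have rpos : 0 < (r%:R : rat) by rewrite ltr0n order_gt0.
pose v (q : place j) : rat := (q x%:A)%:~R.
have degE i : (div_degree (coord_div Phi x E i))%:~R =
    \sum_(q <- s) ((coord_div Phi x E i q)%:~R * (degree q)%:R : rat).
  rewrite (div_degreeE us) => [|q qs]; last by rewrite coord_div_eq0 ?sE ?sx.
  by rewrite rmorph_sum; apply: eq_bigr => q _; rewrite rmorphM.
under [leRHS]eq_bigr => i _ do rewrite degE.
rewrite exchange_big /=.
have local q : \sum_(i < r) ((coord_div Phi x E i q)%:~R * (degree q)%:R : rat) =
    r%:R * (E q * (degree q)%:R) + (r%:R - 1) / 2 * (v q * (degree q)%:R)
    - r%:R / 2 * ((b (under q) - 1) / b (under q) * (degree q)%:R).
  rewrite -mulr_suml sum_floor ?order_gt0 //.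
  - rewrite -slope_denomE -/(v q) /b; set bq : rat := (slope_denom _ _ _)%:~R.
    have bq0 : bq != 0 by rewrite gt_eqF // (lt_le_trans _ (b_ge1 (under q))).
    by field; rewrite bq0 gt_eqF.
  - by rewrite mulrC divfK ?gt_eqF // intr_int.
  - by rewrite -slope_denomE; apply: E_denom.
under [leRHS]eq_bigr => q _ do rewrite local.
rewrite sumrB big_split /= -!mulr_sumr.
have -> : \sum_(q <- s) v q * (degree q)%:R = 0.
  have x0 : x%:A != 0 :> L by apply: alg_neq0.
  have /(congr1 (fun z : int => z%:~R : rat)) := div_degree_principal ffL x0.
  rewrite (div_degreeE us sx) rmorph_sum /= mulr0z => sum0.
  rewrite -[RHS]sum0; by apply: eq_bigr => q _; rewrite rmorphM.
have -> : \sum_(q <- s) E q * (degree q)%:R = divQ_degree E.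
  rewrite /divQ_degree; apply/esym; apply: big_seq_widen => //.
  by move=> q /fsfun_dflt->; rewrite mul0r.
rewrite mulr0 addr0 lerD2l lerN2.
have r2 : 0 <= (r%:R / 2 : rat) by rewrite divr_ge0 // ltW.
apply: (le_trans (ler_wpM2l r2 (sum_ramification_le us))).
by rewrite le_eqVlt; apply/orP; left; apply/eqP; field.
Qed.

End Assembly.

Theorem corollary2p6 (k K : fieldType) (iota : {rmorphism k -> K})
    (L : splittingFieldType K) (Phi : gal_of {:L}) (x : K)
    (E : divQ (ext_const iota L))
    (smoothX : smooth_curve iota)
    (smoothY : smooth_curve (ext_const iota L))
    (galLK : galois 1%AS {:L}%AS)
    (genPhi : 'Gal({:L} / 1)%g = <[Phi]>%g)
    (x_neq0 : x != 0)
    (E_denom : forall q : place (ext_const iota L),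
      (slope_denom Phi x (under q))%:Q * E q \is a Num.int) :
  let r : rat := #[Phi]%g%:R in
  fin_kdim (ext_const iota L) (RRspace Phi x E) [set 0] /\
  r * divQ_degree E - r * ((genus (ext_const iota L))%:Q - 1)
    - r ^+ 2 / 2 * (\sum_(p \in [set: place iota])
        ((slope_denom Phi x p)%:Q - 1)
        / ((slope_denom Phi x p)%:Q * (ram_at L p)%:R)
        * (degree p)%:R)
  <= (kdim (ext_const iota L) (RRspace Phi x E) [set 0])%:R.
Proof.
have [ffK _] := smoothX; have [ffL _] := smoothY.
have dimE := RRspace_kdim Phi x ffL E.
move=> r; split; first by eexists; apply: dimE.
rewrite (kdimE (zero_subspace _ _) dimE) natr_sum.
have := sum_coord_degree ffK ffL galLK genPhi x_neq0 E_denom.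
set ram_sum := \sum_(p \in _) ramification_term _ _ _.
rewrite -/r => degE.
have sumE : \sum_(i < #[Phi]%g) ((div_degree (coord_div Phi x E i))%:~R + 1
      - (genus (ext_const iota L))%:~R : rat)
    <= \sum_(i < #[Phi]%g) (ell (coord_div Phi x E i))%:R.
  apply: ler_sum => i _.
  have := riemann_inequality ffL (divisor_coord Phi x ffL E i).
  by rewrite -(ler_int rat) intrB intrD.
apply: le_trans sumE; rewrite sumrB big_split /= !sumr_const card_ord.
rewrite -[_ *+ _]mulr_natl -[(genus _)%:~R *+ _]mulr_natl -/r.
move: degE; rewrite -/ram_sum; lra.
Qed.
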